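(* Let $k\ge 0$ be an integer, $\varepsilon>0$, $h>0$ the mesh size, and let $(\rho_h^n,g_h^n)_{n\ge 0}$ be the numerical solution produced by the DG-IMEX1 scheme with time step $\Delta t>0$ and with any one of the numerical flux pairs (left-right alternating, right-left alternating, central), initialized by $\rho_h^0=\pi_h\rho|_{t=0}$, $g_h^0=\pi_h g|_{t=0}$. If $$\Delta t\le \Delta t_{stab}:=\begin{cases}\dfrac{h}{\alpha_1+\alpha_2\alpha_3}\Big(h+\min\big(\varepsilon,\tfrac{\alpha_2 h}{\alpha_1}\big)\alpha_3\Big), & k\ge 1,\\[2mm] \dfrac{2h}{\alpha_2\alpha_3}\,(h+\alpha_3\varepsilon), & k=0,\end{cases}$$ then for all integers $n\ge 1$, $$\|\rho_h^{n+1}\|^2+\varepsilon^2|||g_h^n|||^2\le \|\rho_h^{n}\|^2+\varepsilon^2|||g_h^{n-1}|||^2 .$$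
   Context: Model. Either (telegraph equation) $\Omega_v=\{-1,1\}$ and $\langle f\rangle=\int_{\Omega_v} f\,d\mu=\frac12(f(v=-1)+f(v=1))$, or (one-group transport equation in slab geometry) $\Omega_v=[-1,1]$ and $\langle f\rangle=\int_{\Omega_v} f\,d\mu=\frac12\int_{-1}^1 f(v)\,dv$. The kinetic equation is $\varepsilon f_t+v\partial_x f=\frac1\varepsilon(\langle f\rangle-f)$ for $f=f(x,v,t)$, $x\in\Omega_x=[x_{\min},x_{\max}]$, $v\in\Omega_v$, $t>0$, with periodic boundary conditions in $x$. Writing $f=\rho+\varepsilon g$ with $\rho=\langle f\rangle$, $\langle g\rangle=0$, and $\Pi f=\langle f\rangle$, it is equivalent to the micro-macro system $\partial_t\rho+\partial_x\langle vg\rangle=0$, $\partial_t g+\frac1\varepsilon(\mathbf I-\Pi)(v\partial_x g)+\frac1{\varepsilon^2}v\partial_x\rho=-\frac1{\varepsilon^2}g$. The initial data satisfy $\rho|_{t=0}\in L^2(\Omega_x)$, $g|_{t=0}\in L^2(\Omega_x\times\Omega_v;dx\,d\mu)$, $\langle g|_{t=0}\rangle=0$. Discrete space. $\Omega_x$ is divided into $N$ elements $I_i=[x_{i-1/2},x_{i+1/2}]$, $i=1,\dots,N$, of equal length $h$ (with $x_{1/2}$ and $x_{N+1/2}$ identified by periodicity). $U_h^k=\{u\in L^2(\Omega_x): u|_{I_i}\in P^k(I_i)\ \forall i\}$, $P^k$ = polynomials of degree at most $k$. For piecewise smooth $u$, $u^\pm_{i-1/2}$ are the right/left limits at $x_{i-1/2}$,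 $[u]=u^+-u^-$, $\{u\}=\frac12(u^++u^-)$. All sums $\sum_i$ are over $i=1,\dots,N$. $(\cdot,\cdot)$ and $\|\cdot\|$ are the $L^2(\Omega_x)$ inner product and norm, and $|||\phi|||=\langle\|\phi\|^2\rangle^{1/2}$. $\pi_h$ is the $L^2(\Omega_x)$-orthogonal projection onto $U_h^k$ (applied for each $v$). Functions of $(x,v)$ ''in $U_h^k$'' belong to $U_h^k$ in $x$ for each $v$ (and are square integrable in $v$ with respect to $\mu$). Forms. $a_h(g,\phi)=-\sum_i\int_{I_i}\langle vg\rangle\partial_x\phi\,dx-\sum_i\widehat{\langle vg\rangle}_{i-1/2}[\phi]_{i-1/2}$; $d_h(\rho,\psi)=\sum_i\int_{I_i}\rho\,\partial_x\psi\,dx+\sum_i\widehat\rho_{i-1/2}[\psi]_{i-1/2}$; $\mathcal D_h(g;v)\in U_h^k$ is defined by $(\mathcal D_h(g;v),\psi)=-\sum_i\int_{I_i}vg\,\partial_x\psi\,dx-\sum_i\widetilde{(vg)}_{i-1/2}[\psi]_{i-1/2}$ for all $\psi\in U_h^k$, with the upwind flux $\widetilde{vg}=v\{g\}-\frac{|v|}2[g]$ (i.e. $vg^-$ if $v>0$, $vg^+$ if $v<0$); $b_{h,v}(g,\psi)=(\mathcal D_h(g;v)-\langle\mathcal D_h(g;v)\rangle,\psi)$. The fluxes are one of: left-right alternating $\widehat{\langle vg\rangle}=\langle vg\rangle^-,\ \widehat\rho=\rho^+$; right-left alternating $\widehat{\langle vg\rangle}=\langle vg\rangle^+,\ \widehat\rho=\rho^-$;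 central $\widehat{\langle vg\rangle}=\{\langle vg\rangle\},\ \widehat\rho=\{\rho\}$. DG-IMEX1 scheme. Given $\rho_h^n(\cdot),g_h^n(\cdot,v)\in U_h^k$, find $\rho_h^{n+1}(\cdot),g_h^{n+1}(\cdot,v)\in U_h^k$ such that for all $\phi,\psi\in U_h^k$ and all $v\in\Omega_v$, $\big(\frac{\rho_h^{n+1}-\rho_h^n}{\Delta t},\phi\big)+a_h(g_h^n,\phi)=0$, $\big(\frac{g_h^{n+1}-g_h^n}{\Delta t},\psi\big)+\frac1\varepsilon b_{h,v}(g_h^n,\psi)-\frac v{\varepsilon^2}d_h(\rho_h^{n+1},\psi)=-\frac1{\varepsilon^2}(g_h^{n+1},\psi)$. Constants. $C_{\rm inv},\hat C_{\rm inv}>0$ are constants (depending only on $k$) such that for all intervals $[a,b]$ and $w\in P^k([a,b])$: $|w(y)|^2(b-a)\le C_{\rm inv}\int_a^b w^2dx$ for $y=a$ or $b$, and $(b-a)^2\int_a^b|w_x|^2dx\le\hat C_{\rm inv}\int_a^b w^2dx$. With $\|v\|_\infty=\sup_{v\in\Omega_v}|v|$: $\alpha_1=(\|v\|_\infty^2+\langle v^2\rangle)\hat C_{\rm inv}$, $\alpha_2=2(\|v\|_\infty+\langle|v|\rangle)C_{\rm inv}$, $\alpha_3=2\|v\|_\infty C_{\rm inv}$. *)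

(* Defs.v *)
From HB Require Import structures.
From mathcomp Require Import all_boot all_order all_algebra.
From mathcomp Require Import all_classical all_reals all_analysis.
From mathcomp Require Import measurable_realfun.
Set Implicit Arguments.
Unset Strict Implicit.
Unset Printing Implicit Defensive.
Import Order.TTheory GRing.Theory Num.Theory.
Import numFieldNormedType.Exports.
Local Open Scope classical_set_scope.
Local Open Scope ring_scope.

Inductive velocity_model := Telegraph | Slab.

(* The choice of (hat<vg>, hat rho):
   (<vg>^-, rho^+), (<vg>^+, rho^-), ({<vg>}, {rho}) respectively. *)
Inductive flux_pair := LeftRight | RightLeft | Central.

Section Velocity.
Variable R : realType.
Local Notation RT := (measurableTypeR R).

Definition Omega_v (m : velocity_model) : set R :=
  match m with Telegraph => [set -1; 1] | Slab => `[-1, 1] end.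

(* Both measures carry the normalizing factor 1/2. *)
Definition telegraph_measure : set RT -> \bar R :=
  mscale (2^-1)%:nng (measure_add \d_(-1 : RT) \d_(1 : RT)).

Definition slab_measure : set RT -> \bar R :=
  mscale (2^-1)%:nng (mrestr (@lebesgue_measure R) (measurable_itv `[-1, 1])).

HB.instance Definition _ := Measure.on telegraph_measure.
HB.instance Definition _ := Measure.on slab_measure.

Definition mu_v (m : velocity_model) : set RT -> \bar R :=
  match m with Telegraph => telegraph_measure | Slab => slab_measure end.

Section MuMeasure.
Variable m : velocity_model.

Let mu0 : mu_v m set0 = 0%E.
Proof. by case: m => /=; exact: measure0. Qed.

Let mu_ge0 A : (0 <= mu_v m A)%E.
Proof. by case: m => /=; exact: measure_ge0. Qed.

Let mu_sigma_additive : semi_sigma_additive (mu_v m).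
Proof. by case: m => /=; exact: measure_semi_sigma_additive. Qed.

HB.instance Definition _ :=
  isMeasure.Build _ _ _ (mu_v m) mu0 mu_ge0 mu_sigma_additive.

Let mu_setT : mu_v m setT = 1%E.
Proof.
case: m => /=.
  rewrite /telegraph_measure /mscale /= /measure_add /msum.
  rewrite !big_ord_recr big_ord0 /= add0e !diracT -EFinD -EFinM.
  by rewrite mulVf ?pnatr_eq0.
rewrite /slab_measure /mscale /= /mrestr setTI lebesgue_measure_itv /=.
rewrite lte_fin (lt_trans (ltrN10 _) ltr01) -EFinD -EFinM opprK.
by rewrite mulVf ?pnatr_eq0.
Qed.

HB.instance Definition _ := Measure_isProbability.Build _ _ _ (mu_v m) mu_setT.

End MuMeasure.

Definition vmean (m : velocity_model) (f : R -> R) : R :=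
  \int[mu_v m]_(v in Omega_v m) f v.

Definition vsup (m : velocity_model) : R := sup [set `|v| | v in Omega_v m].

Definition sq_integrable d (T : measurableType d)
    (mu : {measure set T -> \bar R}) (D : set T) (f : T -> R) : Prop :=
  measurable_fun D f /\ mu.-integrable D (fun x => (f x ^+ 2)%:E).

End Velocity.

Record mesh (R : realType) := Mesh {
  mesh_min : R;
  mesh_max : R;
  mesh_num : nat;
  mesh_lt : mesh_min < mesh_max;
  mesh_num_gt0 : (0 < mesh_num)%N }.

Section Mesh.
Variables (R : realType) (M : mesh R).
Local Notation N := (mesh_num M).

Definition Omega_x : set R := `[mesh_min M, mesh_max M].

Definition mesh_h : R := (mesh_max M - mesh_min M) / N%:R.

(* Elements and faces are numbered from 0: [face i] is the left end of element
   [i], and [face N] is identified with [face 0]. *)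
Definition face (i : nat) : R := mesh_min M + i%:R * mesh_h.

Definition cell (i : nat) : set R := `[face i, face i.+1].

(* Element-wise defined functions: [u i] is the function on element [i]. *)
Definition piecewise := 'I_N -> R -> R.

Definition broken_poly := {ffun 'I_N -> {poly R}}.

Definition pw (u : broken_poly) : piecewise := fun i x => (u i).[x].

Definition Uh (k : nat) : set broken_poly :=
  [set u : broken_poly | forall i, (size (u i) <= k.+1)%N].

(* One-sided limits at [face i]; the element on the left of [face 0] is the
   last one, by periodicity. *)
Definition trace_right (u : piecewise) (i : 'I_N) : R :=
  lim (u i x @[x --> (face i)^'+]).

Definition trace_left (u : piecewise) (i : 'I_N) : R :=
  lim (u (ord_pred i) x @[x --> (face (ord_pred i).+1)^'-]).

Definition jump (u : piecewise) i : R := trace_right u i - trace_left u i.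

Definition average (u : piecewise) i : R :=
  (trace_right u i + trace_left u i) / 2.

Definition inner (u w : piecewise) : R :=
  \sum_(i < N) \int[@lebesgue_measure R]_(x in cell i) (u i x * w i x).

Definition normL2 (u : broken_poly) : R := Num.sqrt (inner (pw u) (pw u)).

Definition norm_xv (m : velocity_model) (G : R -> broken_poly) : R :=
  Num.sqrt (vmean m (fun v => normL2 (G v) ^+ 2)).

(* In [L2proj] and [D_h] the element of U_h^k satisfying the variational identity
   is selected; 0 is the value of [xget] when there is none (for [L2proj], e.g.
   when [f] is not square integrable). *)
Definition L2proj (k : nat) (f : R -> R) : broken_poly :=
  xget 0 [set u : broken_poly | Uh k u /\ forall phi, Uh k phi ->
    inner (pw u) (pw phi) = inner (fun=> f) (pw phi)].

Definition Uh_v (m : velocity_model) (k : nat) : set (R -> broken_poly) :=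
  [set G : R -> broken_poly | (forall v, Omega_v m v -> Uh k (G v)) /\
    forall (i : 'I_N) x, cell i x ->
      sq_integrable (mu_v m) (Omega_v m) (fun v => (G v i).[x])].

Definition flux_vg (fl : flux_pair) (u : piecewise) (i : 'I_N) : R :=
  match fl with
  | LeftRight => trace_left u i
  | RightLeft => trace_right u i
  | Central => average u i
  end.

Definition flux_rho (fl : flux_pair) (u : piecewise) (i : 'I_N) : R :=
  match fl with
  | LeftRight => trace_right u i
  | RightLeft => trace_left u i
  | Central => average u i
  end.

Definition upwind (v : R) (u : piecewise) (i : 'I_N) : R :=
  v * average u i - `|v| / 2 * jump u i.

Definition vg_mean (m : velocity_model) (G : R -> broken_poly) : piecewise :=
  fun i x => vmean m (fun v => v * (G v i).[x]).

Definition a_h m fl (G : R -> broken_poly) (phi : broken_poly) : R :=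
  - (\sum_(i < N) \int[@lebesgue_measure R]_(x in cell i)
       (vg_mean m G i x * (phi i)^`().[x]))
  - \sum_(i < N) flux_vg fl (vg_mean m G) i * jump (pw phi) i.

Definition d_h fl (rho psi : broken_poly) : R :=
  \sum_(i < N) \int[@lebesgue_measure R]_(x in cell i)
       ((rho i).[x] * (psi i)^`().[x])
  + \sum_(i < N) flux_rho fl (pw rho) i * jump (pw psi) i.

(* Here [u] is the slice g(., v). *)
Definition D_h (k : nat) (u : broken_poly) (v : R) : broken_poly :=
  xget 0 [set D : broken_poly | Uh k D /\ forall psi, Uh k psi ->
    inner (pw D) (pw psi) =
      - (\sum_(i < N) \int[@lebesgue_measure R]_(x in cell i)
           (v * (u i).[x] * (psi i)^`().[x]))
      - \sum_(i < N) upwind v (pw u) i * jump (pw psi) i].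

Definition b_h m k (v : R) (G : R -> broken_poly) (psi : broken_poly) : R :=
  inner (fun i x => (D_h k (G v) v i).[x]
                    - vmean m (fun w => (D_h k (G w) w i).[x]))
        (pw psi).

Definition dg_imex1_step m k fl (eps dt : R)
    (rho : broken_poly) (G : R -> broken_poly)
    (rho' : broken_poly) (G' : R -> broken_poly) : Prop :=
  (forall phi, Uh k phi ->
     inner (pw (dt^-1 *: (rho' - rho))) (pw phi) + a_h m fl G phi = 0) /\
  (forall v psi, Omega_v m v -> Uh k psi ->
     inner (pw (dt^-1 *: (G' v - G v))) (pw psi)
       + eps^-1 * b_h m k v G psi - v / eps ^+ 2 * d_h fl rho' psi
     = - (eps ^+ 2)^-1 * inner (pw (G' v)) (pw psi)).

End Mesh.

Section Constants.
Variable R : realType.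

Definition trace_inverse_const (k : nat) (C : R) : Prop :=
  0 < C /\ forall (a b : R) (w : {poly R}), a < b -> (size w <= k.+1)%N ->
    forall y, y = a \/ y = b ->
    w.[y] ^+ 2 * (b - a) <=
      C * \int[@lebesgue_measure R]_(x in `[a, b]) (w.[x] ^+ 2).

Definition deriv_inverse_const (k : nat) (C : R) : Prop :=
  0 < C /\ forall (a b : R) (w : {poly R}), a < b -> (size w <= k.+1)%N ->
    (b - a) ^+ 2 * \int[@lebesgue_measure R]_(x in `[a, b]) (w^`().[x] ^+ 2) <=
      C * \int[@lebesgue_measure R]_(x in `[a, b]) (w.[x] ^+ 2).

Definition alpha1 m (Chat : R) : R :=
  (vsup R m ^+ 2 + vmean m (fun v => v ^+ 2)) * Chat.

Definition alpha2 m (C : R) : R :=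
  2 * (vsup R m + vmean m (fun v => `|v|)) * C.

Definition alpha3 m (C : R) : R := 2 * vsup R m * C.

Definition dt_stab m (k : nat) (C Chat eps h : R) : R :=
  let a1 := alpha1 m Chat in let a2 := alpha2 m C in let a3 := alpha3 m C in
  if k == 0%N then 2 * h / (a2 * a3) * (h + a3 * eps)
  else h / (a1 + a2 * a3) * (h + Num.min eps (a2 * h / a1) * a3).

End Constants.

(* Main.v *)
(* Testing the rho-equation with rho^n and the g-equation of the previous step
   with g^n, the coupling terms cancel because the paired fluxes make [d_h] the
   adjoint of [a_h]. What remains is to absorb two explicit errors,
   |rho^(n+1) - rho^n|^2 and the upwind form applied to g^n - g^(n-1), into the
   relaxation term |||g^n|||^2 and the upwind dissipation <|v| [g^n]^2>: Young's
   inequality and the inverse inequalities do this under the time step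
   restriction. The projection <D_h> in the g-equation is invisible because
   <g^n> = 0, which holds at time 0 by Fubini and is preserved by the scheme. *)
Require Import Defs.
From HB Require Import structures.
From mathcomp Require Import all_boot all_order all_algebra.
From mathcomp Require Import all_classical all_reals all_analysis.
From mathcomp Require Import measurable_realfun.
From mathcomp Require Import ring lra.
Set Implicit Arguments.
Unset Strict Implicit.
Unset Printing Implicit Defensive.
Import Order.TTheory GRing.Theory Num.Theory.
Import numFieldNormedType.Exports.
Local Open Scope classical_set_scope.
Local Open Scope ring_scope.

(** The scheme holds for each v separately, whereas the estimate is averaged, so every term must
    first be shown integrable in v. This reduces to finitely many scalar functions: once the
    coefficients of g(., v) on each cell are square integrable in v, so is every v-independent
    linear functional of g(., v). [D_h] is only selected by [xget], which says nothing about its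
    dependence on v; inverse Gram matrices turn it into explicit coefficients.

    The two increments behave differently. Testing the g-equation with the new value leaves eps^2/2
    |g^n - g^(n-1)|^2 on the good side, which pays for the increment in the upwind form. Testing the
    rho-equation with the old value leaves |rho^(n+1) - rho^n|^2 / 2 on the bad side, bounded
    through the flux w = <v g^n>.

    Hence the shape of the constants: the suprema in [alpha1] and [alpha2] come from the upwind
    error, the averages <v^2> and <|v|> from Cauchy-Schwarz applied to w. [alpha3] bounds jumps by
    mass, so that the part of the face error exceeding the upwind dissipation can be charged to the
    relaxation term. *)

(** * Integrals of polynomials over an interval *)

Section PolynomialIntegral.
Variable R : realType.
Implicit Types (p q : {poly R}) (a b : R).

Let leb := @lebesgue_measure R.

Lemma integrable_horner p a b :
  leb.-integrable `[a, b] (EFin \o (fun x => p.[x])).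
Proof.
apply: continuous_compact_integrable; first exact: segment_compact.
by apply: continuous_subspaceT => x; exact: continuous_horner.
Qed.

Lemma Rintegral_hornerD p q a b :
  \int[leb]_(x in `[a, b]) (p + q).[x] =
  \int[leb]_(x in `[a, b]) p.[x] + \int[leb]_(x in `[a, b]) q.[x].
Proof.
rewrite -RintegralD//; try exact: integrable_horner.
by apply: eq_Rintegral => x _; rewrite hornerD.
Qed.

Lemma Rintegral_hornerZ p (c : R) a b :
  \int[leb]_(x in `[a, b]) (c *: p).[x] = c * \int[leb]_(x in `[a, b]) p.[x].
Proof.
rewrite -RintegralZl//; last exact: integrable_horner.
by apply: eq_Rintegral => x _; rewrite hornerZ.
Qed.

Lemma Rintegral_deriv p a b : a < b ->
  \int[leb]_(x in `[a, b]) p^`().[x] = p.[b] - p.[a].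
Proof.
move=> ab; rewrite /Rintegral (@continuous_FTC2 _ _ (horner p))//.
- by apply: continuous_subspaceT => x; exact: continuous_horner.
- split => [x _||]; first exact: derivable_horner.
  + exact/cvg_at_right_filter/continuous_horner.
  + exact/cvg_at_left_filter/continuous_horner.
- by move=> x _; rewrite derivE.
Qed.

Definition antideriv p : {poly R} := \poly_(i < (size p).+1) (p`_i.-1 / i%:R).

Lemma antiderivK p : (antideriv p)^`() = p.
Proof.
apply/polyP => i; rewrite coef_deriv coef_poly ltnS.
case: ltnP => [_|szp]; last by rewrite mul0rn nth_default.
by rewrite -(mulr_natr (_ / _)) divfK// pnatr_eq0.
Qed.

(** One infinite family of distinct points of the interval, independent of the degree: it serves
    both to show that a polynomial vanishes and as interpolation nodes. *)
Definition node a b (n : nat) : R := a + (b - a) / n.+1%:R.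

Lemma node_inj a b : a < b -> injective (node a b).
Proof.
move=> ab m n /addrI; have ba0 : b - a != 0 by rewrite subr_eq0 gt_eqF.
by move=> /(mulfI ba0)/invr_inj/eqP; rewrite eqr_nat => /eqP[].
Qed.

Lemma node_in a b n : a < b -> node a b n \in `[a, b].
Proof.
move=> ab; have ba0 : 0 < b - a by rewrite subr_gt0.
rewrite in_itv/= /node lerDl divr_ge0 ?(ltW ba0)//=.
suff : (b - a) / n.+1%:R <= b - a by rewrite -lerBrDl.
by rewrite ler_pdivrMr// ler_peMr ?ler1n// ltW.
Qed.

Lemma poly_node_eq0 p a b n : a < b -> (size p <= n)%N ->
  (forall j, (j < n)%N -> p.[node a b j] = 0) -> p = 0.
Proof.
move=> ab szp p0; apply/eqP; apply: contraTT isT => pn0.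
have := @max_poly_roots _ p [seq node a b j | j <- iota 0 n] pn0.
rewrite size_map size_iota ltnNge szp => /= -> //.
  by apply/allP => x /mapP[j]; rewrite mem_iota => /p0 pj ->; apply/rootP.
by rewrite map_inj_uniq ?iota_uniq//; exact: node_inj.
Qed.

(** An antiderivative of p^2 is nondecreasing and takes equal values at a and b, so it is constant
    on the interval. A polynomial constant at enough nodes is constant, and its derivative p^2 is
    0. *)
Lemma Rintegral_sqr_eq0 p a b : a < b ->
  \int[leb]_(x in `[a, b]) (p.[x] ^+ 2) = 0 -> p = 0.
Proof.
move=> ab; set P := antideriv (p ^+ 2).
have PE c d : c < d -> \int[leb]_(x in `[c, d]) (p.[x] ^+ 2) = P.[d] - P.[c].
  move=> cd; rewrite -Rintegral_deriv//; apply: eq_Rintegral => x _.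
  by rewrite antiderivK horner_exp.
have Ple c d : c <= d -> P.[c] <= P.[d].
  rewrite le_eqVlt => /predU1P[->//|cd]; rewrite -subr_ge0 -PE//.
  by apply: Rintegral_ge0 => x _; exact: sqr_ge0.
rewrite PE// => /eqP; rewrite subr_eq0 => /eqP Pba.
suff /(congr1 (@deriv _)) : P - P.[a]%:P = 0.
  rewrite derivB derivC subr0 antiderivK deriv0.
  by move=> /eqP; rewrite expf_eq0/= => /eqP.
apply: (@poly_node_eq0 _ a b _ ab (leqnn _)) => j _.
have := node_in j ab; rewrite in_itv/= => /andP[aj jb].
rewrite hornerD hornerN hornerC; apply/eqP; rewrite subr_eq0 eq_le.
by apply/andP; split; [rewrite -Pba|]; exact: Ple.
Qed.

End PolynomialIntegral.

(** * Linear functionals as bare functions satisfying [scalar] *)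

Section ScalarFunctionals.
Variables (R : realType) (V : lmodType R) (l : V -> R).
Hypothesis l_lin : scalar l.

Lemma scalar_fun0 : l 0 = 0.
Proof. by have := l_lin (-1) 0 0; rewrite scaler0 addr0; lra. Qed.

Lemma scalar_funD u w : l (u + w) = l u + l w.
Proof. by have := l_lin 1 u w; rewrite scale1r mul1r. Qed.

Lemma scalar_funZ a u : l (a *: u) = a * l u.
Proof. by have := l_lin a u 0; rewrite addr0 scalar_fun0 addr0. Qed.

Lemma scalar_funB u w : l (u - w) = l u - l w.
Proof. by rewrite -scaleN1r addrC l_lin mulN1r addrC. Qed.

Lemma scalar_fun_sum (I : Type) (r : seq I) (P : pred I) (F : I -> V) :
  l (\sum_(i <- r | P i) F i) = \sum_(i <- r | P i) l (F i).
Proof. exact: (big_morph l scalar_funD scalar_fun0). Qed.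

End ScalarFunctionals.

(** * Algebra of broken polynomials: inner product, traces, integration by parts *)

Section BrokenPolynomials.
Variables (R : realType) (M : mesh R).
Local Notation N := (mesh_num M).
Local Notation V := (broken_poly M).
Local Notation leb := (@lebesgue_measure R).
Local Notation h := (mesh_h M).
Implicit Types (u w z : V) (i : 'I_N).

Lemma mesh_h_gt0 : 0 < h.
Proof. by rewrite divr_gt0 ?subr_gt0 ?mesh_lt// ltr0n mesh_num_gt0. Qed.

Lemma faceS n : face M n.+1 - face M n = h.
Proof. by rewrite /face -natr1; ring. Qed.

Lemma face_lt n : face M n < face M n.+1.
Proof. by rewrite -subr_gt0 faceS mesh_h_gt0. Qed.

Lemma face_homo : {homo face M : p q / (p <= q)%N >-> p <= q}.
Proof.
by move=> p q pq; rewrite lerD2l ler_wpM2r ?ler_nat// ltW// mesh_h_gt0.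
Qed.

Lemma measurable_cell n : measurable (cell M n : set (measurableTypeR R)).
Proof. exact: measurable_itv. Qed.

Lemma cell_Omega_x i : cell M i `<=` Omega_x M.
Proof.
have f0 : face M 0 = mesh_min M by rewrite /face mul0r addr0.
have fN : face M N = mesh_max M.
  by rewrite /face mulrC divfK ?subrKC// pnatr_eq0 -lt0n mesh_num_gt0.
move=> x; rewrite /cell /Omega_x /= !in_itv/= => /andP[ax xb].
rewrite -f0 -fN; apply/andP; split.
  by apply: le_trans ax; exact: face_homo.
by apply: (le_trans xb); apply: face_homo; exact: ltn_ord.
Qed.

Definition ip u w : R := inner (pw u) (pw w).

Lemma inner_pw u w : inner (pw u) (pw w) = ip u w.
Proof. by []. Qed.

Lemma ipE u w : ip u w = \sum_(i < N) \int[leb]_(x in cell M i) (u i * w i).[x].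
Proof.
apply: eq_bigr => i _; apply: eq_Rintegral => x _.
by rewrite hornerM.
Qed.

Lemma ipC u w : ip u w = ip w u.
Proof. by rewrite !ipE; apply: eq_bigr => i _; rewrite mulrC. Qed.

Lemma ip_linl w : scalar (ip^~ w).
Proof.
move=> a u z; rewrite !ipE mulr_sumr -big_split; apply: eq_bigr => i _ /=.
rewrite -Rintegral_hornerZ -Rintegral_hornerD; apply: eq_Rintegral => x _.
by rewrite !ffunE mulrDl scalerAl.
Qed.

Lemma ip_linr w : scalar (ip w).
Proof. by move=> a u z; rewrite !(ipC w) ip_linl. Qed.

Lemma ipZl a u w : ip (a *: u) w = a * ip u w.
Proof. exact: scalar_funZ (ip_linl w) a u. Qed.

Lemma ipZr a u w : ip u (a *: w) = a * ip u w.
Proof. exact: scalar_funZ (ip_linr u) a w. Qed.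

Lemma ipBl u w z : ip (u - w) z = ip u z - ip w z.
Proof. exact: scalar_funB (ip_linl z) u w. Qed.

Lemma ipBr u w z : ip z (u - w) = ip z u - ip z w.
Proof. exact: scalar_funB (ip_linr z) u w. Qed.

Lemma ip0r u : ip u 0 = 0.
Proof. exact: scalar_fun0 (ip_linr u). Qed.

Lemma ip0l u : ip 0 u = 0.
Proof. exact: scalar_fun0 (ip_linl u). Qed.

Lemma cell_ip_ge0 u i : 0 <= \int[leb]_(x in cell M i) (u i).[x] ^+ 2.
Proof. by apply: Rintegral_ge0 => x _; exact: sqr_ge0. Qed.

Lemma ip_sqr u : ip u u = \sum_(i < N) \int[leb]_(x in cell M i) (u i).[x] ^+ 2.
Proof. by []. Qed.

Lemma ip_ge0 u : 0 <= ip u u.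
Proof. by rewrite ip_sqr; apply: sumr_ge0 => i _; exact: cell_ip_ge0. Qed.

Lemma ip_eq0 u : ip u u = 0 -> u = 0.
Proof.
rewrite ip_sqr => /eqP; rewrite psumr_eq0; last first.
  by move=> i _; exact: cell_ip_ge0.
move=> /allP u0; apply/ffunP => i; rewrite ffunE.
apply: (Rintegral_sqr_eq0 (face_lt i)); apply/eqP.
by apply: u0; rewrite mem_index_enum.
Qed.

Lemma normL2_sqr u : normL2 u ^+ 2 = ip u u.
Proof. by rewrite sqr_sqrtr// ip_ge0. Qed.

Definition dx u : V := [ffun i => (u i)^`()].

Lemma ip_dx u w : ip u (dx w) =
  \sum_(i < N) \int[leb]_(x in cell M i) ((u i).[x] * (w i)^`().[x]).
Proof.
apply: eq_bigr => i _; apply: eq_Rintegral => x _.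
by rewrite /pw ffunE.
Qed.

Lemma dxD a u w : dx (a *: u + w) = a *: dx u + dx w.
Proof. by apply/ffunP => i; rewrite !ffunE derivD derivZ. Qed.

Definition tr u i : R := (u i).[face M i].
(** For face 0 the evaluation point is [face N], the right end of the last cell: periodicity acts on
    the index of the cell, not on the coordinate. *)
Definition tl u i : R := (u (ord_pred i)).[face M (ord_pred i).+1].
Definition jp u i : R := tr u i - tl u i.

Lemma trace_rightE u i : trace_right (pw u) i = tr u i.
Proof.
by apply: cvg_lim => //; apply/cvg_at_right_filter/continuous_horner.
Qed.

Lemma trace_leftE u i : trace_left (pw u) i = tl u i.
Proof.
by apply: cvg_lim => //; apply/cvg_at_left_filter/continuous_horner.
Qed.

Lemma jumpE u i : jump (pw u) i = jp u i.
Proof. by rewrite /jump trace_rightE trace_leftE. Qed.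

Lemma tr_lin i : scalar (tr^~ i).
Proof. by move=> a u w; rewrite /tr !ffunE !hornerE. Qed.

Lemma tl_lin i : scalar (tl^~ i).
Proof. by move=> a u w; rewrite /tl !ffunE !hornerE. Qed.

Lemma jp_lin i : scalar (jp^~ i).
Proof. by move=> a u w; rewrite /jp tr_lin tl_lin; ring. Qed.

Lemma sum_ord_pred (F : 'I_N -> R) :
  \sum_(i < N) F (ord_pred i) = \sum_(i < N) F i.
Proof. by rewrite [RHS](reindex_inj (@ord_pred_inj N)). Qed.

(** Each cell contributes its two end values; shifting the right-end terms by [ord_pred] gathers
    them at faces, and periodicity leaves no boundary term. *)
Lemma ip_by_parts u w : ip u (dx w) + ip (dx u) w =
  \sum_(i < N) (tl u i * tl w i - tr u i * tr w i).
Proof.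
rewrite sumrB !ipE -big_split/= (sum_ord_pred (fun j =>
  (u j).[face M j.+1] * (w j).[face M j.+1])) -sumrB.
apply: eq_bigr => i _; rewrite -!hornerM -Rintegral_deriv ?face_lt//.
rewrite -Rintegral_hornerD; apply: eq_Rintegral => x _.
by rewrite !ffunE derivM addrC.
Qed.

Lemma d_hE fl u w : d_h fl u w =
  ip u (dx w) + \sum_(i < N) flux_rho fl (pw u) i * jp w i.
Proof.
by rewrite ip_dx; congr (_ + _); apply: eq_bigr => i _; rewrite jumpE.
Qed.

Lemma flux_rho_lin fl i : scalar (fun u => flux_rho fl (pw u) i).
Proof.
move=> a u w; rewrite /flux_rho /average !trace_rightE !trace_leftE.
by case: fl; rewrite ?tr_lin ?tl_lin//; field.
Qed.

Lemma d_h_linr fl u : scalar (d_h fl u).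
Proof.
move=> a w z; rewrite !d_hE dxD ip_linr mulrDr [RHS]addrACA; congr (_ + _).
rewrite mulr_sumr -big_split; apply: eq_bigr => i _.
by rewrite jp_lin /=; ring.
Qed.

(** Discrete adjointness of the coupling terms. After integration by parts it is the face identity
    [phi w] = flux_vg(w) [phi] + flux_rho(phi) [w], which holds for each of the three flux pairs. *)
Lemma a_hE m fl (G : R -> V) w phi : vg_mean m G = pw w ->
  a_h m fl G phi = d_h fl phi w.
Proof.
move=> GW; rewrite /a_h GW d_hE.
under [X in _ - X]eq_bigr do rewrite jumpE.
rewrite -ip_dx.
have -> : ip phi (dx w) = \sum_(i < N) (tl phi i * tl w i - tr phi i * tr w i)
    - ip w (dx phi) by rewrite -ip_by_parts (ipC w) addrK.
rewrite addrAC [RHS]addrC; congr (_ + _).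
rewrite -sumrN -big_split; apply: eq_bigr => i _ /=.
rewrite /flux_vg /flux_rho /average !trace_rightE !trace_leftE /jp.
by case: fl; field.
Qed.

Definition ebasis i (j : nat) : V := [ffun i' => if i' == i then 'X^j else 0].

Lemma Uh_ebasis k i j : (j < k.+1)%N -> Uh k (ebasis i j).
Proof.
move=> jk i'; rewrite ffunE; case: ifP => _; last by rewrite size_poly0.
by rewrite size_polyXn.
Qed.

Lemma Uh_lin k a u w : Uh k u -> Uh k w -> Uh k (a *: u + w).
Proof.
move=> uk wk i; rewrite !ffunE (leq_trans (size_polyD _ _))// geq_max wk andbT.
exact: leq_trans (size_scale_leq _ _) _.
Qed.

Lemma UhB k u w : Uh k u -> Uh k w -> Uh k (u - w).
Proof. by move=> uk wk; rewrite -scaleN1r addrC; exact: Uh_lin. Qed.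

Lemma Uh_decomp k u : Uh k u ->
  u = \sum_(i < N) \sum_(j < k.+1) (u i)`_j *: ebasis i j.
Proof.
move=> uk; apply/ffunP => i; rewrite sum_ffunE (bigD1 i)//=.
rewrite [X in _ + X]big1 => [|i' i'i].
  rewrite addr0 sum_ffunE; under eq_bigr do rewrite !ffunE eqxx.
  by rewrite -poly_def; apply/polyP => j; rewrite coef_poly; case: ltnP => // jk;
    rewrite nth_default// (leq_trans (uk i)).
rewrite sum_ffunE big1// => j _.
by rewrite !ffunE eq_sym (negbTE i'i) scaler0.
Qed.

Lemma scalar_Uh k (l : V -> R) u : scalar l -> Uh k u ->
  l u = \sum_(i < N) \sum_(j < k.+1) (u i)`_j * l (ebasis i j).
Proof.
move=> ll /Uh_decomp{1}->; rewrite scalar_fun_sum//; apply: eq_bigr => i _.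
by rewrite scalar_fun_sum//; apply: eq_bigr => j _; rewrite scalar_funZ.
Qed.

End BrokenPolynomials.

(* Otherwise unification unfolds [ip] to a sum of integrals, at great cost. *)
Opaque ip.

(** * Representation of linear functionals on the discrete space; [D_h] and [L2proj] *)

Section Riesz.
Variables (R : realType) (M : mesh R) (k : nat).
Local Notation N := (mesh_num M).
Local Notation V := (broken_poly M).
Local Notation leb := (@lebesgue_measure R).
Implicit Types (u w : V) (i : 'I_N).

Lemma ip_ebasis_neq i i' (a b : nat) : i' != i ->
  ip (ebasis i' a) (ebasis i b) = 0.
Proof.
move=> i'i; rewrite ipE big1// => j _.
rewrite (_ : _ * _ = 0 *: (0 : {poly R})) ?Rintegral_hornerZ ?mul0r// scaler0.
rewrite !ffunE; case: eqVneq => [->|_]; last by rewrite mul0r.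
by rewrite (negbTE i'i) mulr0.
Qed.

Definition gram i : 'M[R]_k.+1 := \matrix_(a, b) ip (ebasis i a) (ebasis i b).

Lemma ip_ebasis u i (b : 'I_k.+1) : Uh k u ->
  ip u (ebasis i b) = (poly_rV (u i) *m gram i) 0 b.
Proof.
move=> uk; rewrite (scalar_Uh (ip_linl _) uk) (bigD1 i)//=.
rewrite [X in _ + X]big1 => [|i' i'i]; last first.
  by rewrite big1// => j _; rewrite ip_ebasis_neq ?mulr0.
by rewrite addr0 mxE; apply: eq_bigr => a _; rewrite !mxE.
Qed.

(** A row vector killed by the Gram matrix gives a polynomial on cell i orthogonal to all monomials
    there, hence to itself, hence zero. *)
Lemma gram_unit i : gram i \in unitmx.
Proof.
rewrite -row_free_unit; apply: inj_row_free => v v0.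
pose u : V := [ffun i' => if i' == i then rVpoly v else 0].
have ui : u i = rVpoly v by rewrite ffunE eqxx.
have uk : Uh k u.
  move=> i'; rewrite ffunE; case: ifP => _; last by rewrite size_poly0.
  exact: size_poly.
suff /ip_eq0/ffunP/(_ i) : ip u u = 0.
  by rewrite ui ffunE => /(congr1 (@poly_rV _ k.+1)); rewrite rVpolyK linear0.
rewrite (scalar_Uh (ip_linr u) uk) big1// => i' _; rewrite big1// => b _.
have [->|i'i] := eqVneq i' i.
  by rewrite ip_ebasis// ui rVpolyK v0 mxE mulr0.
by rewrite ffunE (negbTE i'i) coef0 mul0r.
Qed.

(** Explicit on purpose: its coefficients are fixed linear combinations of the values
    [l (ebasis i b)], so regularity in v of those values passes to the representer. *)
Definition riesz (l : V -> R) : V :=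
  [ffun i => rVpoly ((\row_(b < k.+1) l (ebasis i b)) *m invmx (gram i))].

Lemma riesz_Uh l : Uh k (riesz l).
Proof. by move=> i; rewrite ffunE size_poly. Qed.

Lemma riesz_coef l i (a : 'I_k.+1) :
  (riesz l i)`_a = \sum_(b < k.+1) l (ebasis i b) * invmx (gram i) b a.
Proof.
by rewrite ffunE coef_rVpoly_ord mxE; apply: eq_bigr => b _; rewrite mxE.
Qed.

Lemma rieszP l : scalar l -> forall psi, Uh k psi -> ip (riesz l) psi = l psi.
Proof.
move=> ll psi psik; rewrite (scalar_Uh (ip_linr _) psik) (scalar_Uh ll psik).
apply: eq_bigr => i _; apply: eq_bigr => b _; congr (_ * _).
rewrite ip_ebasis; last exact: riesz_Uh.
by rewrite ffunE rVpolyK mulmxKV ?gram_unit// mxE.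
Qed.

Lemma ip_inj u w : Uh k u -> Uh k w ->
  (forall psi, Uh k psi -> ip u psi = ip w psi) -> u = w.
Proof.
move=> uk wk uw; apply/eqP; rewrite -subr_eq0; apply/eqP/ip_eq0.
rewrite ipBl uw ?subrr//; exact: UhB.
Qed.

(** The representer satisfies the variational identity and is the only one to do so, so [xget]
    returns it and never its default value. *)
Lemma xget_riesz (l : V -> R) (P : V -> V -> Prop) : scalar l ->
  (forall u psi, Uh k psi -> P u psi <-> ip u psi = l psi) ->
  xget 0 [set u | Uh k u /\ forall psi, Uh k psi -> P u psi] = riesz l.
Proof.
move=> ll Pl; apply: xget_unique => /= [|u [uk Pu]].
  by split=> [|psi psik]; [exact: riesz_Uh|apply/Pl => //; exact: rieszP].
apply: ip_inj => // [|psi psik]; first exact: riesz_Uh.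
by rewrite rieszP//; apply/Pl => //; exact: Pu.
Qed.

(** The right-hand side of the identity selecting [D_h], with v taken out of the volume integral so
    that linearity in each argument is visible. *)
Definition upwind_form (v : R) u w : R :=
  - (v * ip u (dx w)) - \sum_(i < N) upwind v (pw u) i * jp w i.

Lemma upwind_lin v i : scalar (fun u : V => upwind v (pw u) i).
Proof.
move=> a u w; rewrite /upwind /average !jumpE !trace_rightE !trace_leftE.
by rewrite jp_lin tr_lin tl_lin; field.
Qed.

Lemma upwind_form_linr v u : scalar (upwind_form v u).
Proof.
move=> a w z; rewrite /upwind_form dxD ip_linr.
under eq_bigr do rewrite jp_lin mulrDr mulrCA.
by rewrite big_split -mulr_sumr /=; ring.
Qed.

Lemma upwind_form_linl v w : scalar (upwind_form v ^~ w).
Proof.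
move=> a u z; rewrite /upwind_form ip_linl.
under eq_bigr do rewrite upwind_lin mulrDl -mulrA.
by rewrite big_split -mulr_sumr /=; ring.
Qed.

Lemma D_hE u v : D_h k u v = riesz (upwind_form v u).
Proof.
apply: xget_riesz => [|D psi psik]; first exact: upwind_form_linr.
rewrite /upwind_form -ipZl ip_dx.
under [X in _ <-> _ = _ - X]eq_bigr do rewrite -jumpE.
suff -> : \sum_(i < N) \int[leb]_(x in cell M i) (((v *: u) i).[x] *
  ((psi i)^`()).[x]) = \sum_(i < N) \int[leb]_(x in cell M i)
  (v * (u i).[x] * ((psi i)^`()).[x]) by [].
by apply: eq_bigr => i _; apply: eq_Rintegral => x _; rewrite !ffunE hornerZ.
Qed.

Lemma D_hP u v psi : Uh k psi -> ip (D_h k u v) psi = upwind_form v u psi.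
Proof. by move=> psik; rewrite D_hE rieszP//; exact: upwind_form_linr. Qed.

Lemma integrable_mul_horner (f : R -> R) a b (p : {poly R}) :
  leb.-integrable `[a, b] (EFin \o f) ->
  leb.-integrable `[a, b] (EFin \o (fun x => f x * p.[x])).
Proof.
move=> intf; rewrite (_ : EFin \o _ = ((EFin \o f) \* (EFin \o horner p))%E).
  apply: integrableMl => //.
    apply: measurable_funTS; apply: continuous_measurable_fun.
    exact: continuous_horner.
  have : bounded_set (horner p @` `[a, b]).
    apply: compact_bounded; apply: continuous_compact; last first.
      exact: segment_compact.
    by apply: continuous_subspaceT => x; exact: continuous_horner.
  case=> r [rreal rP]; exists r; split=> // c rc x xab.
  by apply: rP => //; exists x.
by apply/funext => x /=; rewrite EFinM.
Qed.

Lemma L2projE (f : R -> R) :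
  (forall i, leb.-integrable (cell M i) (EFin \o f)) ->
  scalar (fun phi : V => inner (fun=> f) (pw phi)) /\
  L2proj M k f = riesz (fun phi => inner (fun=> f) (pw phi)).
Proof.
move=> intf; suff fl : scalar (fun phi : V => inner (fun=> f) (pw phi)).
  by split=> //; exact: xget_riesz.
move=> a phi psi.
rewrite mulr_sumr -big_split; apply: eq_bigr => i _ /=.
rewrite -RintegralZl; last 2 first.
- exact: measurable_cell.
- exact: integrable_mul_horner (phi i) (intf i).
rewrite -RintegralD; last 3 first.
- exact: measurable_cell.
- suff -> : EFin \o (fun x => a * (f x * pw phi i x)) =
    EFin \o (fun x => f x * (a *: phi i).[x]).
    exact: integrable_mul_horner (a *: phi i) (intf i).
  by apply/funext => x /=; rewrite hornerZ mulrCA.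
- exact: integrable_mul_horner (psi i) (intf i).
apply: eq_Rintegral => x _; rewrite /pw !ffunE hornerD hornerZ.
by ring.
Qed.

Lemma L2projP (f : R -> R) i (b : 'I_k.+1) :
  (forall i', leb.-integrable (cell M i') (EFin \o f)) ->
  ip (L2proj M k f) (ebasis i b) = \int[leb]_(x in cell M i) (f x * x ^+ b).
Proof.
move=> intf; have [fl ->] := L2projE intf.
rewrite rieszP//; last exact: Uh_ebasis.
rewrite /inner (bigD1 i)//= big1 => [|i' i'i].
  by rewrite addr0; apply: eq_Rintegral => x _; rewrite /pw ffunE eqxx hornerXn.
under eq_Rintegral do rewrite /pw ffunE (negbTE i'i) horner0 mulr0.
by rewrite Rintegral_cst ?mul0r//; exact: measurable_cell.
Qed.

End Riesz.

(** * Closure properties of real square integrable functions *)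

Section SquareIntegrable.
Context d (T : measurableType d) (R : realType).
Variables (mu : {measure set T -> \bar R}) (D : set T).
Hypothesis mD : measurable D.
Implicit Types f g : T -> R.

Local Notation sq := (sq_integrable mu D).
Local Notation intg f := (mu.-integrable D (EFin \o f)).

Lemma integrable_Dr f g : intg f -> intg g -> intg (fun x => f x + g x).
Proof.
move=> fi gi; have := integrableD mD fi gi.
by apply: eq_integrable => // x _; rewrite /= EFinD.
Qed.

Lemma integrable_Zr (a : R) f : intg f -> intg (fun x => a * f x).
Proof.
move=> fi; have := integrableZl mD a fi.
by apply: eq_integrable => // x _; rewrite /= EFinM.
Qed.

Lemma integrable_sumr I (r : seq I) (F : I -> T -> R) :
  (forall i, intg (F i)) -> intg (fun x => \sum_(i <- r) F i x).
Proof.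
move=> Fi; have := integrable_sum mD r (P := xpredT) (fun i _ => Fi i).
by apply: eq_integrable => // x _; rewrite /= sumEFin.
Qed.

Lemma integrable_dominated f g : measurable_fun D f ->
  (forall x, D x -> `|f x| <= g x) -> intg g -> intg f.
Proof.
move=> mf fg; apply: le_integrable => //; first exact/measurable_EFinP.
by move=> x Dx /=; rewrite lee_fin (le_trans (fg _ Dx))// ler_norm.
Qed.

Lemma sq_integrableM f g : sq f -> sq g -> intg (fun x => f x * g x).
Proof.
move=> [mf if2] [mg ig2].
apply: (@integrable_dominated _ (fun x => f x ^+ 2 + g x ^+ 2)).
- exact: measurable_funM.
- move=> x _; rewrite normrM -(real_normK (num_real (f x))).
  rewrite -(real_normK (num_real (g x))).
  have := sqr_ge0 (`|f x| - `|g x|); have := normr_ge0 (f x).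
  have := normr_ge0 (g x); nra.
- exact: integrable_Dr.
Qed.

Lemma sq_integrableD f g : sq f -> sq g -> sq (fun x => f x + g x).
Proof.
move=> sf sg; have [mf if2] := sf; have [mg ig2] := sg.
split; first exact: measurable_funD.
have := integrable_Dr (integrable_Dr if2 ig2)
  (integrable_Zr 2 (sq_integrableM sf sg)).
by apply: eq_integrable => // x _ /=; congr EFin; ring.
Qed.

Lemma sq_integrable_bounded f g : measurable_fun D f -> sq g ->
  (forall x, D x -> `|f x| <= `|g x|) -> sq f.
Proof.
move=> mf [mg ig2] fg; split=> //.
apply: (@integrable_dominated _ (fun x => g x ^+ 2)) => //.
  exact: measurable_funX.
move=> x Dx; rewrite normrX -(real_normK (num_real (g x))).
by rewrite lerXn2r ?nnegrE// fg.
Qed.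

Lemma sq_integrableZ (a : R) f : sq f -> sq (fun x => a * f x).
Proof.
move=> [mf if2]; split; first exact: measurable_funM.
have := integrable_Zr (a ^+ 2) if2.
by apply: eq_integrable => // x _ /=; rewrite exprMn.
Qed.

Lemma eq_sq_integrable f g : (forall x, D x -> f x = g x) -> sq f -> sq g.
Proof.
move=> fg [mf if2]; split.
  by apply: eq_measurable_fun mf => x /set_mem/fg.
by apply: eq_integrable if2 => // x /set_mem/fg /= ->.
Qed.

Lemma sq_integrable0 : sq (fun=> 0).
Proof.
split; first exact: measurable_cst.
by rewrite expr0n; exact: integrable0.
Qed.

Lemma sq_integrable_sum I (r : seq I) (F : I -> T -> R) :
  (forall i, sq (F i)) -> sq (fun x => \sum_(i <- r) F i x).
Proof.
move=> Fi; elim: r => [|i r IH].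
  by apply: eq_sq_integrable sq_integrable0 => x _; rewrite big_nil.
by apply: eq_sq_integrable (sq_integrableD (Fi i) IH) => x _; rewrite big_cons.
Qed.

End SquareIntegrable.

(** * The velocity average for both models *)

Section VelocityMean.
Variables (R : realType) (m : velocity_model).
Local Notation RT := (measurableTypeR R).
Local Notation mu := (mu_v m : set RT -> \bar R).
Local Notation D := (Omega_v m : set RT).
Implicit Types f g : R -> R.

Definition vsq f := sq_integrable mu D f.
Definition vint f := mu.-integrable D (EFin \o f).

Lemma measurable_Omega_v : measurable D.
Proof.
case: m => /=; last exact: measurable_itv.
by apply: measurableU; exact: measurable_set1.
Qed.
Local Hint Resolve measurable_Omega_v : core.

Lemma Omega_v_le1 (v : R) : D v -> `|v| <= 1.
Proof.
case: m => /= [|]; last by rewrite in_itv/= ler_norml.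
by move=> [->|->]; rewrite ?normrN normr1.
Qed.

Lemma eq_vsq f g : (forall v : R, D v -> f v = g v) -> vsq f -> vsq g.
Proof. exact: (eq_sq_integrable measurable_Omega_v). Qed.

Lemma vsqD f g : vsq f -> vsq g -> vsq (fun v => f v + g v).
Proof. exact: (sq_integrableD measurable_Omega_v). Qed.

Lemma vsqZ (a : R) f : vsq f -> vsq (fun v => a * f v).
Proof. exact: (sq_integrableZ measurable_Omega_v). Qed.

Lemma vsq_sum I (r : seq I) (F : I -> R -> R) :
  (forall i, vsq (F i)) -> vsq (fun v => \sum_(i <- r) F i v).
Proof. exact: sq_integrable_sum. Qed.

Lemma vsq_cst (c : R) : vsq (fun=> c).
Proof.
split; first exact: measurable_cst.
exact: (finite_measure_integrable_cst mu).
Qed.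

Lemma vsq_id : vsq (fun v => v).
Proof.
apply: (@sq_integrable_bounded _ _ _ _ _ _ _ (fun=> 1)) => //.
  exact: vsq_cst.
by move=> x /Omega_v_le1; rewrite normr1.
Qed.

Lemma vsq_norm : vsq (fun v => `|v|).
Proof.
apply: (@sq_integrable_bounded _ _ RT _ _ _ _ (fun v : RT => v : R)) => //.
- exact: measurableT_comp.
- exact: vsq_id.
- by move=> x _; rewrite normr_id.
Qed.

(** Used with the multipliers v and |v|, which are bounded by 1 on both velocity spaces. *)
Lemma vsq_mul_le1 (b f : R -> R) : measurable_fun D (b : RT -> R) ->
  (forall v, D v -> `|b v| <= 1) -> vsq f -> vsq (fun v => b v * f v).
Proof.
move=> mb b1 sf; apply: (sq_integrable_bounded _ _ sf) => //.
  by apply: measurable_funM => //; case: sf.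
by move=> v /b1 bv; rewrite normrM ler_piMl.
Qed.

Lemma vsq_mulv f : vsq f -> vsq (fun v => v * f v).
Proof. by apply: vsq_mul_le1 => // v; exact: Omega_v_le1. Qed.

Lemma vsq_mulnorm f : vsq f -> vsq (fun v => `|v| * f v).
Proof.
apply: vsq_mul_le1; first exact: measurable_funTS.
by move=> v; rewrite normr_id; exact: Omega_v_le1.
Qed.

Lemma vint_mul f g : vsq f -> vsq g -> vint (fun v => f v * g v).
Proof. exact: sq_integrableM. Qed.

Lemma vsq_int f : vsq f -> vint f.
Proof.
move=> sf; have := vint_mul sf (vsq_cst 1).
by apply: eq_integrable => // v _; rewrite /= mulr1.
Qed.

Lemma eq_vint f g : (forall v, D v -> f v = g v) -> vint f -> vint g.
Proof. by move=> fg; apply: eq_integrable => // v /set_mem/fg /= ->. Qed.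

Lemma vint_sum I (r : seq I) (F : I -> R -> R) :
  (forall i, vint (F i)) -> vint (fun v => \sum_(i <- r) F i v).
Proof. exact: integrable_sumr. Qed.

Lemma vintD f g : vint f -> vint g -> vint (fun v => f v + g v).
Proof. exact: integrable_Dr. Qed.

Lemma vintZ (a : R) f : vint f -> vint (fun v => a * f v).
Proof. exact: integrable_Zr. Qed.

Lemma eq_vmean f g : (forall v, D v -> f v = g v) -> vmean m f = vmean m g.
Proof. by move=> fg; apply: eq_Rintegral => v /set_mem/fg. Qed.

Lemma vmeanD f g : vint f -> vint g ->
  vmean m (fun v => f v + g v) = vmean m f + vmean m g.
Proof. exact: RintegralD. Qed.

Lemma vmeanZ (a : R) f : vint f -> vmean m (fun v => a * f v) = a * vmean m f.
Proof. exact: RintegralZl. Qed.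

Lemma vmean0 : vmean m (fun=> 0) = 0 :> R.
Proof. by rewrite /vmean Rintegral_cst// mul0r. Qed.

Lemma vmean_sum I (r : seq I) (F : I -> R -> R) : (forall i, vint (F i)) ->
  vmean m (fun v => \sum_(i <- r) F i v) = \sum_(i <- r) vmean m (F i).
Proof.
move=> Fi; elim: r => [|i r IH].
  by rewrite big_nil -[RHS]vmean0; apply: eq_vmean => v _; rewrite big_nil.
rewrite big_cons -IH -vmeanD//; last exact: integrable_sumr.
by apply: eq_vmean => v _; rewrite big_cons.
Qed.

Lemma vmean_ge0 f : (forall v, D v -> 0 <= f v) -> 0 <= vmean m f.
Proof. exact: Rintegral_ge0. Qed.

Lemma le_vmean f g : vint f -> vint g -> (forall v, D v -> f v <= g v) ->
  vmean m f <= vmean m g.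
Proof. exact: le_Rintegral. Qed.

Lemma vsup_ub (v : R) : D v -> `|v| <= vsup R m.
Proof.
move=> Dv; apply: ub_le_sup; last by exists v.
by exists 1 => _ /= [w Dw <-]; exact: Omega_v_le1.
Qed.

Lemma vsup_gt0 : 0 < vsup R m.
Proof.
apply: (@lt_le_trans _ _ `|1|); first by rewrite normr1.
apply: vsup_ub; case: m => /=; first by right.
by rewrite in_itv/= lexx andbT; lra.
Qed.

Lemma mu_v_Omega_v : mu D = 1%E.
Proof.
rewrite -(@probability_setT _ _ _ (mu_v m)).
case: m => /=.
  rewrite /telegraph_measure /mscale /= /measure_add /msum.
  rewrite !big_ord_recr big_ord0 /= !diracT !diracE.
  have -> : (-1 : RT) \in [set -1; 1] by rewrite inE; left.
  have -> : (1 : RT) \in [set -1; 1] by rewrite inE; right.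
  by rewrite big_ord0.
rewrite /slab_measure /mscale /= /mrestr. rewrite setIid.
by congr (_ * _)%E; congr lebesgue_measure; apply/seteqP; split=> x // [].
Qed.

Lemma vmean_cst (c : R) : vmean m (fun=> c) = c.
Proof.
rewrite /vmean Rintegral_cst// -[RHS]mulr1; congr (_ * _).
exact: (congr1 fine mu_v_Omega_v).
Qed.

(** The average of v + 1 is computed instead: this integrand is nonnegative on [Omega_v], so the
    rules for scaled and summed measures and nonnegative integrands apply. In the slab case its
    antiderivative is x^2/2 + x. *)
Lemma vmean_id : vmean m (fun v => v) = 0 :> R.
Proof.
suff : vmean m (fun v => v + 1) = 1 :> R.
  rewrite vmeanD ?vmean_cst; [lra|exact/vsq_int/vsq_id|exact/vsq_int/vsq_cst].
have meas : measurable_fun D (fun x : RT => (x + 1)%:E : \bar R).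
  by apply/measurable_EFinP; apply: measurable_funD.
have ge0 x : D x -> (0 <= (x + 1)%:E :> \bar R)%E.
  by move=> /Omega_v_le1; rewrite ler_norml lee_fin; lra.
rewrite /vmean /Rintegral; move: meas ge0 (measurable_Omega_v).
case: m => meas ge0 mD.
  rewrite ge0_integral_mscale//= ge0_integral_measure_add//.
  rewrite !integral_dirac// !diracE !mem_set/= ?mul1e; [|by right|by left].
  by lra.
rewrite ge0_integral_mscale//.
rewrite (@eq_measure_integral _ _ _ _ (@lebesgue_measure R)); last first.
  move=> A mA AD; rewrite /= /mrestr. by rewrite setIidl.
pose p : {poly R} := 2^-1 *: 'X^2 + 'X.
have p'E (x : R) : p^`().[x] = x + 1.
  by rewrite derivD derivZ derivXn derivX !hornerE /=; lra.
have N11 : -1 < 1 :> R by lra.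
have := Rintegral_deriv p N11; have := integrable_horner p^`() (-1) 1.
under eq_Rintegral do rewrite p'E.
rewrite (_ : EFin \o _ = fun x : RT => (x + 1)%:E); last first.
  by apply/funext => x /=; rewrite p'E.
move=> intp intpE; rewrite fineM//; last exact: integrable_fin_num.
rewrite [X in _ * X]intpE /p !hornerE /=; lra.
Qed.

End VelocityMean.

(** * Broken polynomials depending on v, and their mean *)

Section VelocityDependentPolynomials.
Variables (R : realType) (m : velocity_model) (M : mesh R) (k : nat).
Local Notation N := (mesh_num M).
Local Notation V := (broken_poly M).
Local Notation RT := (measurableTypeR R).
Local Notation D := (Omega_v m : set RT).
Implicit Types (G H : R -> V) (i : 'I_N).

(** Membership stated through coefficients instead of point values: finitely many scalar functions
    of v then control every linear functional. *)
Definition vL2 G := (forall v : R, D v -> Uh k (G v)) /\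
  forall i (j : 'I_k.+1), vsq m (fun v => (G v i)`_j).

Definition node_mx i : 'M[R]_k.+1 :=
  \matrix_(a, b) (node (face M i) (face M i.+1) b ^+ a).

Lemma poly_node_mx i (p : {poly R}) (b : 'I_k.+1) : (size p <= k.+1)%N ->
  (poly_rV p *m node_mx i) 0 b = p.[node (face M i) (face M i.+1) b].
Proof.
move=> szp; rewrite mxE (horner_coef_wide _ szp).
by apply: eq_bigr => a _; rewrite !mxE.
Qed.

Lemma node_mx_unit i : node_mx i \in unitmx.
Proof.
rewrite -row_free_unit; apply: inj_row_free => v v0.
rewrite -[v]rVpolyK (@poly_node_eq0 _ (rVpoly v) _ _ k.+1 (face_lt M i)).
- by rewrite linear0.
- exact: size_poly.
- move=> j jk; rewrite -(poly_node_mx i (Ordinal jk)) ?size_poly//.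
  by rewrite rVpolyK v0 mxE.
Qed.

(** Coefficients are recovered from the values at k+1 nodes of the cell by inverting the Vandermonde
    matrix [node_mx]. *)
Lemma Uh_v_vL2 G : Uh_v m k G -> vL2 G.
Proof.
move=> [Gk GL2]; split=> // i j.
pose c b := node (face M i) (face M i.+1) b.
have cs (b : 'I_k.+1) : vsq m (fun v => invmx (node_mx i) b j * (G v i).[c b]).
  apply: vsqZ.
  by apply: GL2; exact: node_in (face_lt M i).
apply: eq_vsq (vsq_sum (index_enum _) cs).
move=> v /Gk Gvk; have := mulmxK (node_mx_unit i) (poly_rV (G v i)).
move=> /rowP/(_ j); rewrite [RHS]mxE => <-; rewrite mxE.
by apply: eq_bigr => b _; rewrite poly_node_mx// mulrC.
Qed.

Lemma vL2_scalar G (l : V -> R) : vL2 G -> scalar l -> vsq m (fun v => l (G v)).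
Proof.
move=> [Gk GL2] ll.
apply: (@eq_vsq _ _ (fun v => \sum_(i < N) \sum_(j < k.+1)
    l (ebasis i j) * (G v i)`_j)).
  move=> v /Gk Gvk; rewrite (scalar_Uh ll Gvk).
  by apply: eq_bigr => i _; apply: eq_bigr => j _; rewrite mulrC.
apply: vsq_sum => i.
apply: vsq_sum => j.
exact: vsqZ.
Qed.

(** Expanding the first argument only leaves sums of a coefficient times a linear functional of [H],
    products of two square integrable functions. *)
Lemma vL2_bilinear G H (B : V -> V -> R) : vL2 G -> vL2 H ->
  (forall w, scalar (B^~ w)) -> (forall u, scalar (B u)) ->
  vint m (fun v => B (G v) (H v)).
Proof.
move=> [Gk GL2] HL2 Bl Br.
apply: (@eq_vint _ _ (fun v => \sum_(i < N) \sum_(j < k.+1)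
    (G v i)`_j * B (ebasis i j) (H v))).
  by move=> v /Gk Gvk; rewrite -(scalar_Uh (Bl _) Gvk).
apply: vint_sum => i.
apply: vint_sum => j.
by apply: vint_mul => //; exact: vL2_scalar.
Qed.

Definition meanV G : V :=
  [ffun i => \poly_(j < k.+1) vmean m (fun v => (G v i)`_j)].

Lemma meanV_Uh G : Uh k (meanV G).
Proof. by move=> i; rewrite ffunE size_poly. Qed.

(** The average is taken coefficientwise, so it commutes with every linear functional that does not
    depend on v: point evaluation, traces, inner products. *)
Lemma meanV_scalar G (l : V -> R) : vL2 G -> scalar l ->
  l (meanV G) = vmean m (fun v => l (G v)).
Proof.
move=> [Gk GL2] ll; rewrite (scalar_Uh ll (meanV_Uh G)).
have int1 i (j : 'I_k.+1) : vint m (fun v => l (ebasis i j) * (G v i)`_j).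
  by apply: vintZ; exact: vsq_int.
have int2 i : vint m (fun v => \sum_(j < k.+1) l (ebasis i j) * (G v i)`_j).
  exact: vint_sum.
rewrite (@eq_vmean _ _ _ (fun v => \sum_(i < N) \sum_(j < k.+1)
    l (ebasis i j) * (G v i)`_j)); last first.
  move=> v /Gk Gvk; rewrite (scalar_Uh ll Gvk).
  by apply: eq_bigr => i _; apply: eq_bigr => j _; rewrite mulrC.
rewrite vmean_sum//; apply: eq_bigr => i _; rewrite vmean_sum//.
apply: eq_bigr => j _; rewrite vmeanZ; last exact: vsq_int.
by rewrite ffunE coef_poly ltn_ord mulrC.
Qed.

Lemma vL2_mulv G : vL2 G -> vL2 (fun v => v *: G v).
Proof.
move=> [Gk GL2]; split=> [v Dv i|i j].
  by rewrite ffunE (leq_trans (size_scale_leq _ _))// Gk.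
by apply: eq_vsq (vsq_mulv (GL2 i j)) => v _; rewrite ffunE coefZ.
Qed.

Lemma horner_lin i x : scalar (fun u : V => pw u i x).
Proof. by move=> a u w; rewrite /pw !ffunE !hornerE. Qed.

Lemma vg_meanE G : vL2 G -> vg_mean m G = pw (meanV (fun v => v *: G v)).
Proof.
move=> GL2; apply/funext => i; apply/funext => x.
rewrite (meanV_scalar (vL2_mulv GL2) (horner_lin i x)).
by apply: eq_vmean => v _; rewrite /pw ffunE hornerZ.
Qed.

(** Here the functional itself depends on v, so [vL2_scalar] does not apply directly; the form is
    split into v or |v| times functionals free of v. *)
Lemma vsq_upwind_form G psi : vL2 G -> vsq m (fun v => upwind_form v (G v) psi).
Proof.
move=> GL2.
apply: (@eq_vsq _ _ (fun v => -1 * (v * ip (G v) (dx psi)) +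
  -1 * \sum_(i < N) jp psi i * (v * average (pw (G v)) i +
    - 2^-1 * (`|v| * jp (G v) i)))).
  move=> v _; rewrite /upwind_form !mulN1r; congr (_ - _).
  by apply: eq_bigr => i _; rewrite /upwind jumpE; ring.
apply: vsqD => //; apply: vsqZ => //.
  apply: vsq_mulv; exact: vL2_scalar (ip_linl _).
apply: vsq_sum => // i; apply: vsqZ => //.
apply: vsqD => //; last apply: vsqZ => //.
  apply: vsq_mulv; apply: (vL2_scalar (l := fun u : V => average (pw u) i)) => //.
  exact: (flux_rho_lin Central i).
by apply: vsq_mulnorm; exact: (vL2_scalar GL2 (@jp_lin _ _ i)).
Qed.

Lemma vL2_D_h G : vL2 G -> vL2 (fun v => D_h k (G v) v).
Proof.
move=> GL2; split=> [v _|i j]; first by rewrite D_hE; exact: riesz_Uh.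
apply: (@eq_vsq _ _ (fun v => \sum_(b < k.+1)
  invmx (gram k i) b j * upwind_form v (G v) (ebasis i b))).
  move=> v _; rewrite D_hE riesz_coef.
  by apply: eq_bigr => b _; rewrite mulrC.
apply: vsq_sum => // b; apply: vsqZ => //.
exact: vsq_upwind_form.
Qed.

Lemma b_hE v G psi : vL2 G -> Uh k psi -> b_h m k v G psi =
  upwind_form v (G v) psi - ip (meanV (fun w => D_h k (G w) w)) psi.
Proof.
move=> GL2 psik; rewrite -(@D_hP _ _ k)// -ipBl.
congr (inner _ (pw psi)); apply/funext => i; apply/funext => x.
rewrite (scalar_funB (horner_lin i x)); congr (_ - _).
by rewrite [RHS](meanV_scalar (vL2_D_h GL2) (horner_lin i x)).
Qed.

Lemma vmean_b_h G psi : vL2 G -> Uh k psi ->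
  vmean m (fun v => b_h m k v G psi) = 0.
Proof.
move=> GL2 psik; have DL2 := vL2_D_h GL2.
rewrite (@eq_vmean _ _ _ (fun v => ip (D_h k (G v) v) psi +
  -1 * ip (meanV (fun w => D_h k (G w) w)) psi)); last first.
  by move=> v _; rewrite b_hE// D_hP// mulN1r.
rewrite vmeanD; last 2 first.
- by apply: vsq_int; exact: (vL2_scalar DL2 (ip_linl psi)).
- exact/vsq_int/vsq_cst.
by rewrite vmean_cst (meanV_scalar DL2 (ip_linl psi)) mulN1r subrr.
Qed.

End VelocityDependentPolynomials.

(** * Propagation of <g> = 0 by the scheme *)

Section MeanZero.
Variables (R : realType) (m : velocity_model) (M : mesh R) (k : nat).
Local Notation V := (broken_poly M).
Implicit Types (G : R -> V).

Lemma meanV_eq0 G : vL2 m k G ->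
  (forall i (b : 'I_k.+1), vmean m (fun v => ip (G v) (ebasis i b)) = 0) ->
  meanV m k G = 0.
Proof.
move=> GL2 G0; apply: ip_eq0.
rewrite (scalar_Uh (ip_linr _) (meanV_Uh m k G)) big1// => i _.
by rewrite big1// => b _; rewrite (meanV_scalar GL2 (ip_linl _)) G0 mulr0.
Qed.

(** Average the g-equation over v against a fixed test function: [b_h] has mean 0, the coupling term
    vanishes because <v> = 0, and what is left is (1/eps + eps/dt) <G'> = (eps/dt) <G> = 0 in weak
    form. *)
Lemma meanV_step fl (eps dt : R) rho G rho' G' : 0 < eps -> 0 < dt ->
  vL2 m k G -> vL2 m k G' -> dg_imex1_step m k fl eps dt rho G rho' G' ->
  meanV m k G = 0 -> meanV m k G' = 0.
Proof.
move=> eps0 dt0 GL2 GL2' [_ step] G0; apply: meanV_eq0 => // i b.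
set psi := ebasis i b.
have psik : Uh k psi by exact: Uh_ebasis.
have Gi : vint m (fun v => ip (G v) psi).
  exact: vsq_int (vL2_scalar GL2 (ip_linl psi)).
have Gi' : vint m (fun v => ip (G' v) psi).
  exact: vsq_int (vL2_scalar GL2' (ip_linl psi)).
have G0' : vmean m (fun v => ip (G v) psi) = 0.
  by rewrite -(meanV_scalar GL2 (ip_linl psi)) G0 ip0l.
have := vmean_b_h GL2 psik; rewrite (@eq_vmean _ _ _ (fun v =>
  eps^-1 * d_h fl rho' psi * v + (eps / dt * ip (G v) psi +
  - (eps^-1 + eps / dt) * ip (G' v) psi))); last first.
  move=> v Dv; have := step v psi Dv psik.
  rewrite !inner_pw ipZl ipBl.
  move=> /(congr1 (fun x => eps * x)) E.
  have eps_neq0 : eps != 0 by rewrite gt_eqF.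
  have dt_neq0 : dt != 0 by rewrite gt_eqF.
  have : eps * (eps^-1 * b_h m k v G psi) = eps * (v / eps ^+ 2 * d_h fl rho' psi
     - (eps ^+ 2)^-1 * ip (G' v) psi - dt^-1 * (ip (G' v) psi - ip (G v) psi)).
    move: E; lra.
  by rewrite mulVKf// => ->; field; rewrite ?eps_neq0 ?dt_neq0.
have vi : vint m (fun v : R => v) by exact/vsq_int/vsq_id.
rewrite vmeanD ?vmeanD; last 4 first.
- exact: vintZ.
- exact: vintZ.
- exact: vintZ.
- by apply: vintD; exact: vintZ.
rewrite (vmeanZ _ vi) (vmeanZ _ Gi) (vmeanZ _ Gi') G0' vmean_id !mulr0 !add0r.
set X := vmean m _ => /eqP; rewrite mulf_eq0.
by rewrite oppr_eq0 gt_eqF ?addr_gt0 ?divr_gt0 ?invr_gt0//= => /eqP.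
Qed.

End MeanZero.

(** * Mean zero of the projected initial datum *)

Section MeanZeroInitial.
Variables (R : realType) (m : velocity_model) (M : mesh R) (k : nat).
Local Notation N := (mesh_num M).
Local Notation V := (broken_poly M).
Local Notation RT := (measurableTypeR R).
Local Notation D := (Omega_v m : set RT).
Local Notation leb := (@lebesgue_measure R).
Local Notation mu := (mu_v m).
Implicit Types (G : R -> V) (i : 'I_N).

(** On a cell times [Omega_v], a set of finite measure, the bounded monomial is square integrable; a
    product of two square integrable functions is integrable. *)
Lemma integrable_cell_moment (g0 : R -> R -> R) i (b : nat) :
  sq_integrable (leb \x mu)%E (Omega_x M `*` Omega_v m)
    (fun xv => g0 xv.1 xv.2) ->
  (leb \x mu)%E.-integrable setT
    ((fun xv => (g0 xv.1 xv.2 * xv.1 ^+ b)%:E) \_ (cell M i `*` D)).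
Proof.
move=> [mg ig].
have mS : measurable (cell M i `*` D : set (RT * RT)).
  by apply: measurableX; [exact: measurable_cell|exact: measurable_Omega_v].
have mO : measurable (Omega_x M `*` D : set (RT * RT)).
  by apply: measurableX; [exact: measurable_itv|exact: measurable_Omega_v].
have SO : cell M i `*` D `<=` Omega_x M `*` D.
  by move=> -[x v] [/= /cell_Omega_x].
apply: (integrable_mkcond _ mS).1.
have Sfin : ((leb \x mu)%E (cell M i `*` D) < +oo)%E.
  rewrite product_measure1E; last 2 first.
  - exact: measurable_cell.
  - exact: measurable_Omega_v.
  rewrite lte_mul_pinfty//.
  - rewrite /cell ge0_fin_numE//= lebesgue_measure_itv/=.
    by case: ifP => _; rewrite ltry.
  - by rewrite (@le_lt_trans _ _ 1%E) ?probability_le1 ?ltry//;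
      exact: measurable_Omega_v.
apply: (@sq_integrableM _ _ R _ _ mS (fun xv => g0 xv.1 xv.2)
  (fun xv => xv.1 ^+ b)).
  by split; [exact: measurable_funS mg|exact: integrableS ig].
pose B := (`|mesh_min M| + `|mesh_max M|) ^+ b.
apply: (@sq_integrable_bounded _ _ _ _ _ mS _ (fun=> B)).
- by apply: measurable_funX; exact: measurable_funTS measurable_fst.
- split; first exact: measurable_cst.
  apply/integrableP; split; first exact: measurable_cst.
  by rewrite integral_cst// lte_mul_pinfty// fin_num_abs.
- move=> [x v] [/= /cell_Omega_x]; rewrite /Omega_x /= in_itv/= => /andP[x1 x2] _.
  rewrite normrX [leRHS]ger0_norm ?exprn_ge0 ?addr_ge0// /B.
  rewrite lerXn2r ?nnegrE ?addr_ge0// ler_norml.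
  have := ler_norm (mesh_max M); have := ler_norm (- mesh_min M).
  have := normr_ge0 (mesh_max M); have := normr_ge0 (mesh_min M).
  by rewrite normrN => ? ? ? ?; apply/andP; split; lra.
Qed.

(** Fubini applied to the moments of [g0] on a cell: one order of integration gives 0, the other
    gives the mean of the moments of the projections. [H] extends the integrand by zero so that both
    integrals run over whole spaces. *)
Lemma meanV_L2proj (g0 : R -> R -> R) (G : R -> V) :
  sq_integrable (leb \x mu)%E (Omega_x M `*` Omega_v m)
    (fun xv => g0 xv.1 xv.2) ->
  {ae leb, forall x, Omega_x M x -> vmean m (g0 x) = 0} ->
  vL2 m k G ->
  {ae mu, forall v, Omega_v m v -> G v = L2proj M k (fun x => g0 x v)} ->
  meanV m k G = 0.
Proof.
have mD := @measurable_Omega_v R m.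
move=> g0L2 g0mean GL2 Gproj; apply: meanV_eq0 => // i b.
pose H i' (c : nat) : RT * RT -> \bar R :=
  (fun xv => (g0 xv.1 xv.2 * xv.1 ^+ c)%:E) \_ (cell M i' `*` D).
have intH i' c : (leb \x mu)%E.-integrable setT (H i' c).
  exact: integrable_cell_moment.
have HD i' c v : D v -> (fun x => H i' c (x, v)) =
    (fun x => (g0 x v * x ^+ c)%:E) \_ (cell M i').
  move=> Dv; apply/funext => x; rewrite /H /patch.
  congr (if _ then _ else _); apply/idP/idP; rewrite !inE => //.
  by move=> [].
have HND i' c v : ~ D v -> (fun x => H i' c (x, v)) = cst 0%E.
  move=> Dv; apply/funext => x; rewrite /H /patch ifF//.
  by apply/negbTE/negP; rewrite inE => -[].
have Hcell i' c x : cell M i' x -> (fun v => H i' c (x, v)) =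
    (fun v => (g0 x v * x ^+ c)%:E) \_ D.
  move=> cx; apply/funext => v; rewrite /H /patch.
  congr (if _ then _ else _); apply/idP/idP; rewrite !inE => //.
  by move=> [].
have HNcell i' c x : ~ cell M i' x -> (fun v => H i' c (x, v)) = cst 0%E.
  move=> cx; apply/funext => v; rewrite /H /patch ifF//.
  by apply/negbTE/negP; rewrite inE => -[].
(* [L2proj] is characterised only for integrable slices. Fubini on the moment of order 0 provides
   this for almost every v, on all cells at once. *)
have slice : {ae mu, forall v, D v -> forall i',
    leb.-integrable (cell M i') (EFin \o (fun x => g0 x v))}.
  have : {ae mu, forall v, forall i' : 'I_N,
      leb.-integrable setT (fun x => H i' 0%N (x, v))}.
    by apply: filter_forall => i'; exact: ae_integrable2 (intH i' 0%N).
  apply: filterS => v Hv Dv i'.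
  have := Hv i'; rewrite HD// => /(integrable_mkcond _ (measurable_cell M i')).
  apply: eq_integrable.
    exact: measurable_cell.
  by move=> x _ /=; rewrite expr0 mulr1.
have Gint : vint m (fun v => ip (G v) (ebasis i b)).
  exact: vsq_int (vL2_scalar GL2 (ip_linl _)).
(* Velocity first: for almost every x the inner integral is x^b <g0(x, .)> = 0. *)
have lhs : (\int[leb]_x \int[mu]_v H i b (x, v) = 0)%E.
  rewrite -[RHS](integral0 leb setT); apply: ae_eq_integral => //.
    exact: measurable_fubini_F (intH i b).
  have FF : Filter (nbhs (almost_everywhere leb)).
    exact: ae_filter_ringOfSetsType.
  apply: (filterS2 _ _ g0mean (ae_integrable1 (intH i 0%N))) => x mx ix _.
  have [cx|cx] := pselect (cell M i x); last by rewrite HNcell// integral0.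
  rewrite (Hcell _ _ _ cx) -integral_mkcond.
  have ig0 : vint m (g0 x).
    move: ix; rewrite (Hcell _ _ _ cx) => /(integrable_mkcond _ mD).
    by apply: eq_integrable => // v _ /=; rewrite expr0 mulr1.
  under eq_integral do rewrite EFinM.
  rewrite integralZr//; rewrite -[X in (X * _)%E]fineK; last first.
    exact: integrable_fin_num.
  have := mx (cell_Omega_x cx); rewrite /vmean /Rintegral => ->.
  by rewrite mul0e.
(* Space first: for almost every v the inner integral is the moment of g0(., v), which its
   projection shares. *)
have rhs : (\int[mu]_v \int[leb]_x H i b (x, v) =
    \int[mu]_(v in D) (ip (G v) (ebasis i b))%:E)%E.
  rewrite [RHS]integral_mkcond; apply: ae_eq_integral => //.
  - exact: measurable_fubini_G (intH i b).
  - exact: measurable_int ((integrable_mkcond _ mD).1 Gint).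
  apply: (filterS2 _ _ slice Gproj) => v sv Gv _.
  have [Dv|Dv] := pselect (D v); last first.
    by rewrite HND// integral0 patchE ifF//; apply/negbTE/negP; rewrite inE.
  rewrite HD// -integral_mkcond patchE mem_set// Gv// L2projP; last exact: sv.
  rewrite fineK//; apply: integrable_fin_num; first exact: measurable_cell.
  have := integrable_mul_horner 'X^b (sv Dv i); apply: eq_integrable.
    exact: measurable_cell.
  by move=> x _ /=; rewrite hornerXn.
by rewrite /vmean /Rintegral -rhs -(Fubini (intH i b)) lhs.
Qed.

End MeanZeroInitial.

(** * Inverse and Young estimates for fixed v *)

Section SpatialEstimates.
Variables (R : realType) (M : mesh R) (k : nat) (C Chat : R).
Local Notation N := (mesh_num M).
Local Notation V := (broken_poly M).
Local Notation h := (mesh_h M).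
Hypothesis C_ok : trace_inverse_const k C.
Hypothesis Chat_ok : deriv_inverse_const k Chat.
Implicit Types (u w : V) (i : 'I_N).

Let C_gt0 : 0 < C. Proof. by case: C_ok. Qed.
Let h_gt0 : 0 < h. Proof. exact: mesh_h_gt0. Qed.

Definition jump_energy u : R := \sum_(i < N) jp u i ^+ 2.

Lemma jump_energy_ge0 u : 0 <= jump_energy u.
Proof. by apply: sumr_ge0 => i _; exact: sqr_ge0. Qed.

Lemma trace_sum_le u : Uh k u ->
  (\sum_(i < N) tr u i ^+ 2) * h <= C * ip u u /\
  (\sum_(i < N) tl u i ^+ 2) * h <= C * ip u u.
Proof.
move=> uk; split.
  rewrite mulr_suml ip_sqr mulr_sumr; apply: ler_sum => i _.
  rewrite -(faceS M i); apply: (C_ok.2 _ _ (u i)) => //; first exact: face_lt.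
  by left.
rewrite /tl (sum_ord_pred (fun j => (u j).[face M j.+1] ^+ 2)).
rewrite mulr_suml ip_sqr mulr_sumr; apply: ler_sum => i _.
rewrite -(faceS M i); apply: (C_ok.2 _ _ (u i)) => //; first exact: face_lt.
by right.
Qed.

Lemma ip_dx_le u : Uh k u -> h ^+ 2 * ip (dx u) (dx u) <= Chat * ip u u.
Proof.
move=> uk; rewrite !ip_sqr !mulr_sumr; apply: ler_sum => i _.
rewrite -(faceS M i); have := Chat_ok.2 _ _ (u i) (face_lt M i) (uk i).
by rewrite ffunE.
Qed.

Lemma dx_eq0 u : Uh 0 u -> dx u = 0.
Proof.
move=> u0; apply/ffunP => i; rewrite !ffunE.
by rewrite (size1_polyC (u0 i)) derivC.
Qed.

Lemma jump_energy_le u : Uh k u -> jump_energy u * h <= 4 * C * ip u u.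
Proof.
move=> uk; have [tru tlu] := trace_sum_le uk.
have : jump_energy u <=
    2 * (\sum_(i < N) tr u i ^+ 2) + 2 * (\sum_(i < N) tl u i ^+ 2).
  rewrite !mulr_sumr -big_split; apply: ler_sum => i _ /=.
  rewrite /jp; have := sqr_ge0 (tr u i + tl u i); lra.
move=> /(ler_wpM2r (ltW h_gt0)); lra.
Qed.

Lemma flux_rho_sum_le fl u : Uh k u ->
  (\sum_(i < N) flux_rho fl (pw u) i ^+ 2) * h <= C * ip u u.
Proof.
move=> uk; have [tru tlu] := trace_sum_le uk.
case: fl; rewrite /flux_rho /average.
- by under eq_bigr do rewrite trace_rightE.
- by under eq_bigr do rewrite trace_leftE.
- under eq_bigr do rewrite trace_rightE trace_leftE.
  have : \sum_(i < N) ((tr u i + tl u i) / 2) ^+ 2 <=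
      2^-1 * (\sum_(i < N) tr u i ^+ 2) + 2^-1 * (\sum_(i < N) tl u i ^+ 2).
    rewrite !mulr_sumr -big_split; apply: ler_sum => i _ /=.
    have := sqr_ge0 (tr u i - tl u i); lra.
  move=> /(ler_wpM2r (ltW h_gt0)); lra.
Qed.

Lemma ip_young (c : R) u w : 0 < c ->
  ip u w <= c * ip u u + (4 * c)^-1 * ip w w.
Proof.
move=> c0; have := ip_ge0 ((2 * c) *: u - w).
rewrite ipBl !ipBr.
rewrite !ipZl !ipZr (ipC w u) => p.
rewrite -(ler_pM2l (_ : 0 < 4 * c)) ?mulr_gt0//.
rewrite mulrDr mulrA mulVKf ?gt_eqF ?mulr_gt0//; lra.
Qed.

Lemma sum_young (c : R) (a b : 'I_N -> R) : 0 < c ->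
  \sum_(i < N) a i * b i <=
    c * \sum_(i < N) a i ^+ 2 + (4 * c)^-1 * \sum_(i < N) b i ^+ 2.
Proof.
move=> c0; rewrite !mulr_sumr -big_split; apply: ler_sum => i _ /=.
have p := sqr_ge0 (2 * c * a i - b i).
rewrite -(ler_pM2l (_ : 0 < 4 * c)) ?mulr_gt0//.
rewrite mulrDr [X in _ <= _ + X]mulrA mulfV ?mul1r ?gt_eqF ?mulr_gt0//; lra.
Qed.

Lemma face_young (c : R) (a b : 'I_N -> R) (E : R) : 0 < c ->
  (\sum_(i < N) a i ^+ 2) * h <= C * E ->
  \sum_(i < N) a i * b i <=
    c * E + (4 * c)^-1 * (C / h) * \sum_(i < N) b i ^+ 2.
Proof.
(* The weight c h / C is the one for which the trace inequality turns the sum of squared traces into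
   exactly c E. *)
move=> c0 aE; have ch : 0 < c * h / C by rewrite divr_gt0// mulr_gt0.
apply: (le_trans (sum_young a b ch)); apply: lerD.
  rewrite -(ler_pM2r (_ : 0 < C / c)) ?divr_gt0//.
  rewrite (_ : _ * (C / c) = (\sum_(i < N) a i ^+ 2) * h); last first.
    by field; rewrite !gt_eqF.
  rewrite (_ : _ * (C / c) = C * E)//; field; rewrite !gt_eqF//.
rewrite le_eqVlt; apply/orP; left; apply/eqP; congr (_ * _).
by field; rewrite !gt_eqF.
Qed.

(* For piecewise constants the volume terms vanish, so that the mass term need
   not be shared between volume and face terms: this gains a factor 2. *)
Definition young_factor : R := if k == 0%N then 2^-1 else 1.

(** The volume and face parts of the tested equation each cost a quarter of |delta|^2 (Young with c
    = 1/4), leaving half on the left. When k = 0 the face part alone may cost the whole half (c =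
    1/2), whence the factor 1/2. *)
Lemma rho_increment_le fl (dt : R) (delta w : V) : Uh k delta -> Uh k w ->
  ip delta delta = - dt * d_h fl delta w ->
  ip delta delta / 2 <= young_factor * dt ^+ 2 *
    (ip (dx w) (dx w) + C / h * jump_energy w).
Proof.
move=> dk wk; rewrite d_hE => E.
have flux_le := flux_rho_sum_le fl dk.
have jE : \sum_(i < N) (- dt * jp w i) ^+ 2 = dt ^+ 2 * jump_energy w.
  by rewrite mulr_sumr; apply: eq_bigr => i _; ring.
have face c c0 := @face_young c (fun i => flux_rho fl (pw delta) i)
  (fun i => - dt * jp w i) _ c0 flux_le.
have fE : \sum_(i < N) flux_rho fl (pw delta) i * (- dt * jp w i) =
    - dt * \sum_(i < N) flux_rho fl (pw delta) i * jp w i.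
  by rewrite mulr_sumr; apply: eq_bigr => i _; ring.
rewrite jE fE in face.
rewrite /young_factor; case: ifP => [/eqP k0|_].
  rewrite k0 in wk; have := face 2^-1 ltac:(lra); move: E.
  rewrite (dx_eq0 wk) ip0r ip0r.
  lra.
have := face 4^-1 ltac:(lra); move: E.
have := @ip_young 4^-1 delta (- dt *: dx w) ltac:(lra).
rewrite !ipZr !ipZl; lra.
Qed.

(** Integration by parts cancels the central part v {u} [u] of the flux, leaving only the upwind
    dissipation. *)
Lemma upwind_form_diag v u : upwind_form v u u = `|v| / 2 * jump_energy u.
Proof.
have := ip_by_parts u u; rewrite (ipC (dx u)) => E.
rewrite /upwind_form (_ : ip u (dx u) = 2^-1 *
  \sum_(i < N) (tl u i * tl u i - tr u i * tr u i)); last by lra.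
rewrite !mulr_sumr -sumrN -sumrB; apply: eq_bigr => i _.
by rewrite /upwind /average jumpE trace_rightE trace_leftE /jp; field.
Qed.

Lemma upwind_form_le (v eps dt s : R) (delta w : V) : `|v| <= s ->
  Uh k delta -> Uh k w ->
  eps * dt * upwind_form v delta w <= eps ^+ 2 / 2 * ip delta delta +
    young_factor * dt ^+ 2 *
      (s ^+ 2 * ip (dx w) (dx w) + s * (C / h) * (`|v| * jump_energy w)).
Proof.
move=> vs dk wk; have [tru tlu] := trace_sum_le dk.
(* The trace on the upwind side; the upwind flux is v times it. *)
pose t i := if 0 <= v then tl delta i else tr delta i.
have t_le : (\sum_(i < N) t i ^+ 2) * h <= C * ip delta delta.
  by rewrite /t; case: (0 <= v).
have upE i : upwind v (pw delta) i = v * t i.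
  rewrite /upwind /average jumpE trace_rightE trace_leftE /jp /t.
  by case: (lerP 0 v) => v0;
    [rewrite ger0_norm//; field|rewrite ltr0_norm//; field].
(* Only one factor |v| is traded for s here: the other must survive in the face term to match the
   dissipation |v| [w]^2. *)
have v2 : v ^+ 2 <= s * `|v|.
  by rewrite -(real_normK (num_real v)) expr2 ler_wpM2r.
have v2' : v ^+ 2 <= s ^+ 2.
  by rewrite -(real_normK (num_real v)) lerXn2r ?nnegrE ?(le_trans _ vs).
have X0 := ip_ge0 (dx w); have J0 := jump_energy_ge0 w.
have Ch0 : 0 <= C / h by rewrite divr_ge0// ltW.
have vX : v ^+ 2 * ip (dx w) (dx w) <= s ^+ 2 * ip (dx w) (dx w).
  exact: ler_wpM2r.
have vJ : v ^+ 2 * (C / h * jump_energy w) <=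
    s * (C / h) * (`|v| * jump_energy w).
  rewrite (_ : s * _ * _ = s * `|v| * (C / h * jump_energy w)); last by ring.
  by apply: ler_wpM2r => //; rewrite mulr_ge0.
have et_le : (\sum_(i < N) (eps * t i) ^+ 2) * h <=
    C * (eps ^+ 2 * ip delta delta).
  rewrite (_ : \sum_(i < N) _ = eps ^+ 2 * \sum_(i < N) t i ^+ 2).
    by rewrite -mulrA [leRHS]mulrCA ler_wpM2l ?sqr_ge0.
  by rewrite mulr_sumr; apply: eq_bigr => i _; ring.
have jE : \sum_(i < N) (- dt * v * jp w i) ^+ 2 =
    dt ^+ 2 * v ^+ 2 * jump_energy w.
  by rewrite mulr_sumr; apply: eq_bigr => i _; ring.
have face c c0 := @face_young c (fun i => eps * t i)
  (fun i => - dt * v * jp w i) _ c0 et_le.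
have fE : \sum_(i < N) eps * t i * (- dt * v * jp w i) =
    eps * dt * - \sum_(i < N) upwind v (pw delta) i * jp w i.
  rewrite mulrN mulr_sumr -sumrN; apply: eq_bigr => i _.
  by rewrite upE; ring.
rewrite jE fE in face.
have dt2 := sqr_ge0 dt.
rewrite /upwind_form /young_factor mulrDr; case: ifP => [/eqP k0|_].
  rewrite k0 in wk; have := face 2^-1 ltac:(lra).
  have := ler_wpM2l dt2 vJ.
  rewrite (dx_eq0 wk) ip0r ip0r.
  lra.
have := face 4^-1 ltac:(lra).
have := ler_wpM2l dt2 vJ; have := ler_wpM2l dt2 vX.
have := @ip_young 4^-1 (eps *: delta) ((- dt * v) *: dx w) ltac:(lra).
rewrite !ipZr !ipZl; lra.
Qed.

End SpatialEstimates.

(** * Scalar inequalities behind the time step restriction *)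

Section TimeStepBound.
Variable R : realType.

(** If dt a2 <= eps h, the jump terms compare directly. Otherwise the excess (dt a2 - eps h) J is
    converted into E by J h <= 2 a3 E, and the bound on dt (a1 + a2 a3) closes the estimate. *)
Lemma stability_bound (h eps dt a1 a2 a3 E J : R) :
  0 < h -> 0 < eps -> 0 < a1 -> 0 < a2 -> 0 < a3 -> 0 < dt ->
  0 <= E -> 0 <= J -> J * h <= 2 * a3 * E ->
  dt <= h / (a1 + a2 * a3) * (h + Num.min eps (a2 * h / a1) * a3) ->
  dt * (a1 / h ^+ 2 * E + a2 / (2 * h) * J) <= E + eps / 2 * J.
Proof.
move=> h0 e0 a10 a20 a30 dt0 E0 J0 JE dt_le.
have h2 : 0 < h ^+ 2 by rewrite exprn_gt0.
have s0 : 0 < a1 + a2 * a3 by rewrite addr_gt0// mulr_gt0.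
have bound c : 0 <= c -> h / (a1 + a2 * a3) * (h + c * a3) * (a1 + a2 * a3) =
    h ^+ 2 + c * a3 * h.
  by move=> _; field; rewrite gt_eqF.
set c := Num.min _ _ in dt_le.
have c_eps : c <= eps by rewrite ge_min lexx.
have c_a : c * a1 <= a2 * h.
  by rewrite -ler_pdivlMr// ge_min lexx orbT.
have c0 : 0 < c by rewrite lt_min e0 divr_gt0// mulr_gt0.
have H : dt * (a1 + a2 * a3) <= h ^+ 2 + c * a3 * h.
  by rewrite -(bound c (ltW c0)) ler_wpM2r// ltW.
suff : dt * (2 * a1 * E + a2 * h * J) <= h ^+ 2 * (2 * E + eps * J).
  move=> G; rewrite -(ler_pM2l (_ : 0 < 2 * h ^+ 2)) ?mulr_gt0//.
  rewrite (_ : 2 * h ^+ 2 * (dt * _) = dt * (2 * a1 * E + a2 * h * J)).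
    by apply: (le_trans G); lra.
  by field; rewrite gt_eqF.
have [le1|gt1] := leP (dt * a2) (eps * h).
  (* This is the purpose of the cap a2 h / a1 in the minimum: inserted in the bound on dt, it gives
     exactly h^2 / a1. *)
  have dta1 : dt * a1 <= h ^+ 2.
    rewrite leNgt; apply/negP => gt2.
    have [ceps|ceps] := leP (dt * a2) (c * h).
      have : dt * a1 * a2 <= c * h * a1.
        by rewrite mulrAC ler_wpM2r// ltW.
      have : c * h * a1 <= h ^+ 2 * a2.
        by have := ler_wpM2r (ltW h0) c_a; lra.
      by have : h ^+ 2 * a2 < dt * a1 * a2 by [rewrite ltr_pM2r|]; lra.
    have := ltr_pM2r a30 (c * h) (dt * a2); rewrite ceps; lra.
  have := ler_wpM2r E0 dta1.
  have := ler_wpM2r (mulr_ge0 (ltW h0) J0) le1; lra.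
have P : 0 <= dt * a2 - eps * h by lra.
have := ler_wpM2l P JE.
have eH : dt * (a1 + a2 * a3) <= h ^+ 2 + eps * a3 * h.
  apply: (le_trans H); rewrite lerD2l.
  by rewrite (ler_wpM2r (ltW h0))// (ler_wpM2r (ltW a30)).
have := ler_wpM2r E0 eH; lra.
Qed.

(** Same splitting without a volume term; the factor 1/2 moves the threshold to 2 eps h. *)
Lemma stability_bound0 (h eps dt a2 a3 E J : R) :
  0 < h -> 0 < eps -> 0 < a2 -> 0 < a3 -> 0 < dt ->
  0 <= E -> 0 <= J -> J * h <= 2 * a3 * E ->
  dt <= 2 * h / (a2 * a3) * (h + a3 * eps) ->
  dt * (2^-1 * (a2 / (2 * h) * J)) <= E + eps / 2 * J.
Proof.
move=> h0 e0 a20 a30 dt0 E0 J0 JE dt_le.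
have h2 : 0 < h ^+ 2 by rewrite exprn_gt0.
have H : dt * (a2 * a3) <= 2 * h * (h + a3 * eps).
  have s0 : 0 < a2 * a3 by rewrite mulr_gt0.
  rewrite -ler_pdivlMr//; apply: le_trans dt_le _.
  by rewrite mulrAC.
rewrite -(ler_pM2l (_ : 0 < 4 * h ^+ 2)) ?mulr_gt0//.
rewrite (_ : 4 * h ^+ 2 * (dt * _) = dt * (a2 * h * J)); last first.
  by field; rewrite gt_eqF.
have [le1|gt1] := leP (dt * a2) (2 * eps * h).
  have := ler_wpM2r (mulr_ge0 (ltW h0) J0) le1.
  have := mulr_ge0 (ltW h2) E0; lra.
have P : 0 <= dt * a2 - 2 * eps * h by lra.
have := ler_wpM2l P JE; have := ler_wpM2r E0 H; lra.
Qed.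

Lemma dt_stab_bound m k (C Chat eps h dt E J X : R) :
  0 < h -> 0 < eps -> 0 < C -> 0 < Chat -> 0 < dt ->
  0 <= E -> 0 <= J -> J * h <= 2 * alpha3 m C * E -> h ^+ 2 * X <= Chat * E ->
  (k = 0%N -> X = 0) -> dt <= dt_stab m k C Chat eps h ->
  dt * (young_factor R k * ((vsup R m ^+ 2 + vmean m (fun v => v ^+ 2)) * X +
    C / h * (vsup R m + vmean m (fun v => `|v|)) * J)) <= E + eps / 2 * J.
Proof.
move=> h0 e0 C0 Chat0 dt0 E0 J0 JE XE k0X; rewrite /dt_stab.
have A1 : 0 <= vmean m (fun v : R => `|v|) by apply: vmean_ge0.
have A2 : 0 <= vmean m (fun v : R => v ^+ 2).
  by apply: vmean_ge0 => v _; exact: sqr_ge0.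
have s0 := vsup_gt0 R m.
have a1E : alpha1 m Chat = (vsup R m ^+ 2 + vmean m (fun v => v ^+ 2)) * Chat.
  by [].
have a2E : alpha2 m C = 2 * (vsup R m + vmean m (fun v => `|v|)) * C by [].
have a3E : alpha3 m C = 2 * vsup R m * C by [].
move: JE a1E a2E a3E A1 A2 s0; move: (alpha1 _ _) (alpha2 _ _) (alpha3 _ _).
move: (vsup _ _) (vmean _ _) (vmean _ _).
move=> s P Q a1 a2 a3 JE a1E a2E a3E A1 A2 s0.
have a10 : 0 < a1 by rewrite a1E mulr_gt0// ltr_wpDr// exprn_gt0.
have a20 : 0 < a2 by rewrite a2E !mulr_gt0// ltr_wpDr.
have a30 : 0 < a3 by rewrite a3E !mulr_gt0.
have h_neq0 : h != 0 by rewrite gt_eqF.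
rewrite (_ : C / h * _ * J = a2 / (2 * h) * J); last by rewrite a2E; field.
rewrite /young_factor; case: ifP => [/eqP/k0X ->|_] dt_le.
  by rewrite mulr0 add0r; exact: stability_bound0 dt_le.
have := stability_bound h0 e0 a10 a20 a30 dt0 E0 J0 JE dt_le.
apply: le_trans; rewrite mul1r (ler_wpM2l (ltW dt0))// lerD2r a1E.
rewrite -!mulrA ler_wpM2l ?addr_ge0 ?sqr_ge0//.
rewrite -(ler_pM2l (exprn_gt0 2 h0)) (_ : h ^+ 2 * (Chat * _) = Chat * E)//.
by field.
Qed.

(** Adding both energy inequalities cancels dt d. The errors carry dt^2, so the time step bound is
    used after multiplication by dt, and its right-hand side is then dt E + eps dt / 2 J, precisely
    the available damping. *)
Lemma energy_closure (K dt eps h P Q s C E Ep J X XW JW d r r' : R) :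
  0 < dt -> 0 <= K -> 0 <= C / h ->
  r' / 2 - r / 2 + dt * d <= K * dt ^+ 2 * (XW + C / h * JW) ->
  eps ^+ 2 / 2 * E - eps ^+ 2 / 2 * Ep + eps * dt / 2 * J - dt * d + dt * E <=
    K * dt ^+ 2 * s ^+ 2 * X + K * dt ^+ 2 * (s * (C / h)) * J ->
  XW <= P * X -> JW <= Q * J ->
  dt * (K * ((s ^+ 2 + P) * X + C / h * (s + Q) * J)) <= E + eps / 2 * J ->
  r' + eps ^+ 2 * E <= r + eps ^+ 2 * Ep.
Proof.
move=> dt0 K0 Ch0 Er Eg XWle JWle bound.
have := ler_wpM2l (ltW dt0) bound.
have Kdt : 0 <= K * dt ^+ 2 by rewrite mulr_ge0 ?sqr_ge0.
have := ler_wpM2l Kdt (lerD XWle (ler_wpM2l Ch0 JWle)).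
by move: Er Eg; lra.
Qed.

End TimeStepBound.

(** * Velocity-averaged estimates; Cauchy-Schwarz for the flux *)

Section Averages.
Variables (R : realType) (m : velocity_model) (M : mesh R) (k : nat).
Local Notation N := (mesh_num M).
Local Notation V := (broken_poly M).
Local Notation h := (mesh_h M).
Local Notation D := (Omega_v m).
Implicit Types (G : R -> V) (u w : V).

Definition flux_mean G : V := meanV m k (fun v => v *: G v).

Lemma norm_xv_sqr G : norm_xv m G ^+ 2 = vmean m (fun v => ip (G v) (G v)).
Proof.
rewrite /norm_xv sqr_sqrtr; last by apply: vmean_ge0 => v _; exact: sqr_ge0.
by apply: eq_vmean => v _; rewrite normL2_sqr.
Qed.

Lemma vint_ip G G' : vL2 m k G -> vL2 m k G' ->
  vint m (fun v => ip (G v) (G' v)).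
Proof.
by move=> GL2 GL2'; apply: (vL2_bilinear GL2 GL2') => u;
  [exact: ip_linl|exact: ip_linr].
Qed.

Lemma vint_dx G : vL2 m k G -> vint m (fun v => ip (dx (G v)) (dx (G v))).
Proof.
move=> GL2; apply: (vL2_bilinear (B := fun u w => ip (dx u) (dx w)) GL2 GL2).
  by move=> w a u z; rewrite dxD ip_linl.
by move=> u a w z; rewrite dxD ip_linr.
Qed.

Lemma vint_jump G : vL2 m k G -> vint m (fun v => `|v| * jump_energy (G v)).
Proof.
move=> GL2; have jL2 i : vsq m (fun v => jp (G v) i).
  exact: (vL2_scalar GL2 (@jp_lin _ _ i)).
apply: (@eq_vint _ _ (fun v => \sum_(i < N) `|v| * jp (G v) i * jp (G v) i)).
  by move=> v _; rewrite mulr_sumr; apply: eq_bigr => i _; rewrite -mulrA -expr2.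
by apply: vint_sum => i; apply: vint_mul => //; exact: vsq_mulnorm.
Qed.

(* Cauchy-Schwarz in [v] for the flux [w = <v G>] and a semi-inner product [B];
   [p] and [q] are weights with [p q = v^2], and the pointwise hypothesis says
   that the quadratic polynomial [t |-> B (a w - t b G) (a w - t b G)] is
   nonnegative, where [p = a^2], [q = b^2] and [v = a b]. *)
Lemma vmean_cauchy_schwarz G (B : V -> V -> R) (p q : R -> R) :
  vL2 m k G -> (forall u, scalar (B u)) -> vint m p ->
  vint m (fun v => q v * B (G v) (G v)) ->
  let w := flux_mean G in
  (forall v, D v -> 0 <= p v) -> 0 <= B w w ->
  (forall v t, D v -> 0 <= B w w * p v +
    (- (2 * t) * B w (v *: G v) + t ^+ 2 * (q v * B (G v) (G v)))) ->
  B w w <= vmean m p * vmean m (fun v => q v * B (G v) (G v)).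
Proof.
move=> GL2 Br pint qint w p0 Bw0 poly.
set P := vmean m p; set Q := vmean m _.
have BwG : vmean m (fun v => B w (v *: G v)) = B w w.
  by rewrite -(meanV_scalar (vL2_mulv GL2) (Br w)).
have BwGint : vint m (fun v => B w (v *: G v)).
  exact: vsq_int (vL2_scalar (vL2_mulv GL2) (Br w)).
have quad t : 0 <= B w w * P + (- (2 * t) * B w w + t ^+ 2 * Q).
  rewrite -[X in _ <= _ + (_ * X + _)]BwG /P /Q.
  rewrite -vmeanZ// -[X in _ <= _ + (X + _)]vmeanZ//.
  rewrite -[X in _ <= _ + (_ + X)]vmeanZ//.
  rewrite -vmeanD ?vintZ// -vmeanD ?vintD ?vintZ//.
  by apply: vmean_ge0 => v Dv; exact: poly.
have P0 : 0 <= P by exact: vmean_ge0.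
(* Only the quadratic is known to be nonnegative; if Q < 0, it would be negative at t = 1 + B w w P
   / (-Q). *)
have Q0 : 0 <= Q.
  rewrite leNgt; apply/negP => Qlt.
  have := quad (1 + B w w * P / - Q); have X0 : 0 <= B w w * P / - Q.
    by rewrite divr_ge0 ?mulr_ge0// oppr_ge0 ltW.
  set X := _ / _ in X0 *; have XE : B w w * P = X * - Q.
    by rewrite /X divfK// oppr_eq0 lt_eqF.
  by rewrite XE; nra.
(* At t = P the quadratic is P (P Q - B w w). *)
have [Pgt|Ple] := ltP 0 P.
  have := quad P; rewrite -subr_ge0 => H.
  rewrite -subr_ge0 -(pmulr_rge0 _ Pgt); lra.
have PE : P = 0 by apply/eqP; rewrite eq_le Ple.
rewrite PE mul0r leNgt; apply/negP => Bgt.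
(* With P = 0 the quadratic is t^2 Q - 2 t B w w, negative at t = B w w / (Q + 1) if B w w > 0;
   adding 1 avoids dividing by Q = 0. *)
have Q1 : 0 < Q + 1 by lra.
have := quad (B w w / (Q + 1)); rewrite PE mulr0 add0r.
rewrite (_ : _ + _ = - (B w w ^+ 2 * (Q + 2) / (Q + 1) ^+ 2)); last first.
  by field; rewrite gt_eqF.
rewrite oppr_ge0 leNgt divr_gt0// ?exprn_gt0// mulr_gt0 ?exprn_gt0//; lra.
Qed.

(** Weights p = v^2 and q = 1: the volume dissipation to be matched carries no power of v, which
    puts <v^2> into [alpha1]. *)
Lemma dx_mean_le G : vL2 m k G ->
  ip (dx (flux_mean G)) (dx (flux_mean G)) <=
    vmean m (fun v => v ^+ 2) * vmean m (fun v => ip (dx (G v)) (dx (G v))).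
Proof.
move=> GL2; set w := flux_mean G.
rewrite -(@eq_vmean _ _ (fun v => 1 * ip (dx (G v)) (dx (G v)))
  (fun v => ip (dx (G v)) (dx (G v)))); last first.
  by move=> v _; rewrite mul1r.
apply: (@vmean_cauchy_schwarz G (fun u w => ip (dx u) (dx w)) (fun v => v ^+ 2)
  (fun=> 1) GL2).
- by move=> u a w' z; rewrite dxD ip_linr.
- by have := vint_mul (vsq_id R m) (vsq_id R m); apply: eq_vint => v _.
- by apply: eq_vint (vint_dx GL2) => v _; rewrite mul1r.
- by move=> v _; exact: sqr_ge0.
- exact: ip_ge0.
- move=> v t _; have := ip_ge0 (v *: dx w - t *: dx (G v)).
  have -> : dx (v *: G v) = v *: dx (G v).
    by apply/ffunP => i; rewrite !ffunE derivZ.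
  rewrite ipBl !ipBr.
  rewrite !ipZl !ipZr.
  by rewrite (ipC (dx (G v)) (dx w)) -/w; lra.
Qed.

(** Weights p = q = |v|, because the upwind dissipation controls the jumps only with the factor |v|;
    this puts <|v|> into [alpha2]. The sign of v is absorbed into t. *)
Lemma jump_mean_le G : vL2 m k G ->
  jump_energy (flux_mean G) <=
    vmean m (fun v => `|v|) * vmean m (fun v => `|v| * jump_energy (G v)).
Proof.
move=> GL2.
apply: (@vmean_cauchy_schwarz G (fun u w => \sum_(i < N) jp u i * jp w i)
  (fun v => `|v|) (fun v => `|v|)) => //.
- move=> u a w z; rewrite mulr_sumr -big_split; apply: eq_bigr => i _ /=.
  by rewrite jp_lin; ring.
- exact/vsq_int/vsq_norm.
- exact: vint_jump.
- exact: jump_energy_ge0.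
- move=> v t _; set w := flux_mean G.
  rewrite mulr_suml !mulr_sumr -!big_split; apply: sumr_ge0 => i _ /=.
  rewrite (scalar_funZ (@jp_lin _ _ i)); have [v0|v0] := lerP 0 v.
    rewrite ger0_norm//.
    by have := mulr_ge0 v0 (sqr_ge0 (jp w i - t * jp (G v) i)); lra.
  rewrite ltr0_norm//; have nv : 0 <= - v by lra.
  by have := mulr_ge0 nv (sqr_ge0 (jp w i + t * jp (G v) i)); lra.
Qed.

Lemma vmean_dx_le Chat G : deriv_inverse_const k Chat -> vL2 m k G ->
  h ^+ 2 * vmean m (fun v => ip (dx (G v)) (dx (G v))) <=
    Chat * vmean m (fun v => ip (G v) (G v)).
Proof.
move=> Chat_ok GL2; have i1 := vint_ip GL2 GL2; have i2 := vint_dx GL2.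
rewrite -(vmeanZ (h ^+ 2) i2) -(vmeanZ Chat i1).
apply: le_vmean; [exact: vintZ|exact: vintZ|move=> v Dv].
by apply: (ip_dx_le Chat_ok); exact: GL2.1.
Qed.

Lemma vmean_jump_le C G : trace_inverse_const k C -> vL2 m k G ->
  vmean m (fun v => `|v| * jump_energy (G v)) * h <=
    2 * alpha3 m C * vmean m (fun v => ip (G v) (G v)).
Proof.
move=> C_ok GL2; have i1 := vint_ip GL2 GL2; have i2 := vint_jump GL2.
rewrite mulrC -(vmeanZ h i2) -(vmeanZ (2 * alpha3 m C) i1).
apply: le_vmean; [exact: vintZ|exact: vintZ|move=> v Dv].
have := jump_energy_le C_ok (GL2.1 v Dv); have vs := vsup_ub Dv.
rewrite /alpha3; move: vs (jump_energy_ge0 (G v)) (mesh_h_gt0 M) (ip_ge0 (G v)).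
move: (vsup _ _) (jump_energy _) (ip _ _) h => s j E h' vs j0 h0 E0 jE.
have := ler_pM (normr_ge0 v) (mulr_ge0 j0 (ltW h0)) vs jE; lra.
Qed.

End Averages.

(** * Energy inequalities for the two equations *)

Section EnergyBalance.
Variables (R : realType) (m : velocity_model) (fl : flux_pair) (k : nat).
Variables (M : mesh R) (eps dt C : R).
Local Notation V := (broken_poly M).
Local Notation h := (mesh_h M).
Hypotheses (eps_gt0 : 0 < eps) (dt_gt0 : 0 < dt).
Hypothesis C_ok : trace_inverse_const k C.

(** The equation is used twice: tested with [rho] for the balance, and with the increment
    [rho' - rho] to bound the square left over. *)
Lemma rho_energy rho rho' (G G' : R -> V) : vL2 m k G -> Uh k rho -> Uh k rho' ->
  dg_imex1_step m k fl eps dt rho G rho' G' ->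
  ip rho' rho' / 2 - ip rho rho / 2 + dt * d_h fl rho (flux_mean m k G) <=
  young_factor R k * dt ^+ 2 *
    (ip (dx (flux_mean m k G)) (dx (flux_mean m k G)) +
     C / h * jump_energy (flux_mean m k G)).
Proof.
move=> GL2 rk rk' [step _]; set w := flux_mean m k G.
have stepE phi : Uh k phi -> ip (rho' - rho) phi = - dt * d_h fl phi w.
  move=> phik; have := step phi phik; rewrite (a_hE fl phi (vg_meanE GL2)) -/w.
  rewrite inner_pw ipZl => E.
  have -> : d_h fl phi w = - (dt^-1 * ip (rho' - rho) phi) by lra.
  by field; rewrite gt_eqF.
have dk : Uh k (rho' - rho) by exact: UhB.
have wk : Uh k w by exact: meanV_Uh.
have := rho_increment_le C_ok dk wk (stepE _ dk); have := stepE _ rk.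
rewrite !ipBl !ipBr (ipC rho rho').
lra.
Qed.

(** Tested with [G' v]; the upwind form of [G v] is that of [G' v], which is dissipative, minus that
    of the increment, whose bound consumes the square of the increment entirely. The sum is written
    with [+] and negated coefficients so that [vmeanD] and [vmeanZ] apply to each term. *)
Lemma g_energy_pointwise rho rho' (G G' : R -> V) v : vL2 m k G -> vL2 m k G' ->
  dg_imex1_step m k fl eps dt rho G rho' G' -> Omega_v m v ->
  eps ^+ 2 / 2 * ip (G' v) (G' v) + - (eps ^+ 2 / 2) * ip (G v) (G v) +
  eps * dt / 2 * (`|v| * jump_energy (G' v)) +
  - (eps * dt) * ip (meanV m k (fun w => D_h k (G w) w)) (G' v) +
  - dt * d_h fl rho' (v *: G' v) + dt * ip (G' v) (G' v) <=
  young_factor R k * dt ^+ 2 * vsup R m ^+ 2 * ip (dx (G' v)) (dx (G' v)) +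
  young_factor R k * dt ^+ 2 * (vsup R m * (C / h)) * (`|v| * jump_energy (G' v)).
Proof.
move=> GL2 GL2' [_ step] Dv.
have Gk := GL2.1 v Dv; have Gk' := GL2'.1 v Dv.
have E := step v _ Dv Gk'.
rewrite b_hE// !inner_pw ipZl in E.
rewrite ipBl in E.
have Up := upwind_form_le C_ok eps dt (vsup_ub Dv) (UhB Gk' Gk) Gk'.
rewrite (scalar_funB (upwind_form_linl _ _)) upwind_form_diag in Up.
rewrite !ipBl !ipBr in Up.
rewrite (ipC (G' v) (G v)) in Up.
rewrite (scalar_funZ (d_h_linr _ _)).
set a := ip (G' v) (G' v) in E Up *; set b := ip (G v) (G' v) in E Up.
set c := ip (G v) (G v) in Up *; set U := upwind_form _ _ _ in E Up.
set d := d_h _ _ _ in E *; set B := ip (meanV _ _ _) _ in E *.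
have E' : eps ^+ 2 * (a - b) + eps * dt * (U - B) - dt * (v * d) + dt * a = 0.
  rewrite (_ : _ + dt * a = dt * eps ^+ 2 * (dt^-1 * (a - b) + eps^-1 * (U - B)
    - v / eps ^+ 2 * d + (eps ^+ 2)^-1 * a)); last by field; rewrite !gt_eqF.
  by rewrite E mulNr addNr mulr0.
move: E' Up; lra.
Qed.

Lemma g_energy rho rho' (G G' : R -> V) : vL2 m k G -> vL2 m k G' ->
  meanV m k G' = 0 -> dg_imex1_step m k fl eps dt rho G rho' G' ->
  eps ^+ 2 / 2 * vmean m (fun v => ip (G' v) (G' v)) -
  eps ^+ 2 / 2 * vmean m (fun v => ip (G v) (G v)) +
  eps * dt / 2 * vmean m (fun v => `|v| * jump_energy (G' v)) -
  dt * d_h fl rho' (flux_mean m k G') +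
  dt * vmean m (fun v => ip (G' v) (G' v)) <=
  young_factor R k * dt ^+ 2 * vsup R m ^+ 2 *
    vmean m (fun v => ip (dx (G' v)) (dx (G' v))) +
  young_factor R k * dt ^+ 2 * (vsup R m * (C / h)) *
    vmean m (fun v => `|v| * jump_energy (G' v)).
Proof.
move=> GL2 GL2' G'0 step.
set Dm := meanV m k (fun w => D_h k (G w) w).
have i1 := vint_ip GL2' GL2'; have i2 := vint_ip GL2 GL2.
have i3 := vint_jump GL2'; have i4 := vint_dx GL2'.
have i5 : vint m (fun v => ip Dm (G' v)).
  exact: vsq_int (vL2_scalar GL2' (ip_linr Dm)).
have i6 : vint m (fun v => d_h fl rho' (v *: G' v)).
  exact: vsq_int (vL2_scalar (vL2_mulv GL2') (d_h_linr _ _)).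
have m5 : vmean m (fun v => ip Dm (G' v)) = 0.
  by rewrite -(meanV_scalar GL2' (ip_linr Dm)) G'0 ip0r.
have m6 : vmean m (fun v => d_h fl rho' (v *: G' v)) =
    d_h fl rho' (flux_mean m k G').
  by rewrite -(meanV_scalar (vL2_mulv GL2') (d_h_linr _ _)).
have := @le_vmean _ _ _ _ _ _ (fun v Dv => g_energy_pointwise GL2 GL2' step Dv).
(* The two premises discharged are integrability of the left and right sides. *)
do 2 (move=> /(_ ltac:(do ?[apply: vintD]; exact: vintZ))).
rewrite !vmeanD ?vmeanZ//; do ?[apply: vintD]; do ?[exact: vintZ].
rewrite -/Dm m5 m6; set E := vmean m _; set J := vmean m _; set E' := vmean m _.
set X := vmean m _; set d := d_h _ _ _ => H; clear -H; lra.
Qed.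

End EnergyBalance.

Theorem theorem3p3 (R : realType) (m : velocity_model) (fl : flux_pair)
    (k : nat) (M : mesh R) (eps dt Cinv Cinv_hat : R)
    (rho0 : R -> R) (g0 : R -> R -> R)
    (rho : nat -> broken_poly M) (g : nat -> R -> broken_poly M)
    (eps_gt0 : 0 < eps) (dt_gt0 : 0 < dt)
    (Cinv_ok : trace_inverse_const k Cinv)
    (Cinv_hat_ok : deriv_inverse_const k Cinv_hat)
    (rho0_L2 : sq_integrable (@lebesgue_measure R) (Omega_x M) rho0)
    (g0_L2 : sq_integrable
       (@lebesgue_measure R \x mu_v m)%E (Omega_x M `*` Omega_v m)
       (fun xv => g0 xv.1 xv.2))
    (g0_mean : {ae @lebesgue_measure R, forall x, Omega_x M x ->
       vmean m (g0 x) = 0})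
    (rho_Uh : forall n, Uh k (rho n))
    (g_Uh : forall n, Uh_v m k (g n))
    (rho_init : rho 0%N = L2proj M k rho0)
    (g_init : {ae mu_v m, forall v, Omega_v m v ->
       g 0%N v = L2proj M k (fun x => g0 x v)})
    (scheme : forall n,
       dg_imex1_step m k fl eps dt (rho n) (g n) (rho n.+1) (g n.+1))
    (dt_le : dt <= dt_stab m k Cinv Cinv_hat eps (mesh_h M)) :
  forall n : nat, (1 <= n)%N ->
    normL2 (rho n.+1) ^+ 2 + eps ^+ 2 * norm_xv m (g n) ^+ 2 <=
    normL2 (rho n) ^+ 2 + eps ^+ 2 * norm_xv m (g n.-1) ^+ 2.
Proof.
have gL2 n : vL2 m k (g n) by exact: Uh_v_vL2.
have g_mean n : meanV m k (g n) = 0.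
  elim: n => [|n IH]; first exact: meanV_L2proj g0_L2 g0_mean (gL2 0%N) g_init.
  exact: meanV_step eps_gt0 dt_gt0 (gL2 n) (gL2 n.+1) (scheme n) IH.
have energyE n : normL2 (rho n.+1) ^+ 2 + eps ^+ 2 * norm_xv m (g n) ^+ 2 =
    ip (rho n.+1) (rho n.+1) + eps ^+ 2 * vmean m (fun v => ip (g n v) (g n v)).
  by congr (_ + _ * _); [exact: normL2_sqr|exact: norm_xv_sqr].
(* With n shifted by one, the rho-step starting at [n.+1] and the g-step starting at [n] both
   contain [d_h] of [rho n.+1] and the flux of [g n.+1], so these terms cancel. *)
case=> [//|n] _; rewrite (energyE n.+1) (energyE n).
have C_gt0 := Cinv_ok.1; have h_gt0 := mesh_h_gt0 M.
apply: (energy_closure dt_gt0 _ _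
  (rho_energy dt_gt0 Cinv_ok (gL2 n.+1) (rho_Uh n.+1) (rho_Uh n.+2) (scheme n.+1))
  (g_energy eps_gt0 dt_gt0 Cinv_ok (gL2 n) (gL2 n.+1) (g_mean n.+1) (scheme n))
  (dx_mean_le (gL2 n.+1)) (jump_mean_le (gL2 n.+1))).
- by rewrite /young_factor; case: ifP.
- by rewrite divr_ge0// ltW.
- apply: dt_stab_bound dt_le => //.
  + exact: Cinv_hat_ok.1.
  + by apply: vmean_ge0 => v _; exact: ip_ge0.
  + by apply: vmean_ge0 => v _; rewrite mulr_ge0 ?jump_energy_ge0.
  + exact: vmean_jump_le Cinv_ok (gL2 n.+1).
  + exact: vmean_dx_le Cinv_hat_ok (gL2 n.+1).
  + move=> k0; rewrite -[RHS](vmean0 R m); apply: eq_vmean => v Dv.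
    by have := (gL2 n.+1).1 v Dv; rewrite k0 => /dx_eq0 ->; exact: ip0l.
Qed.
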